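(* Let $K=I(X,R)$ be the incidence algebra of a locally finite preordered set $X$ over a $T$-algebra $R$. Suppose that $K$ satisfies Condition (II) and that one of the following two conditions holds: (1) for any $x,y\in X$, $R_x\cong R_y$ implies $n_x=n_y$; (2) for any $n,m\in\mathbb N$, $M(n,R)\cong M(m,R)$ implies $n=m$. Then, with $\mathrm{Out}\,X$ regarded as a subgroup of $\mathrm{Aut}\,K$ (contained in $\Lambda$) and of $\Omega$ as described in the context: (a) $\Omega=\Omega_1\rtimes\mathrm{Out}\,X$, $\ \Lambda=C\rtimes\mathrm{Out}\,X$, $\ \mathrm{Aut}\,K=\mathrm{In}_1(\mathrm{Aut}\,K)\rtimes C\rtimes\mathrm{Out}\,X$. (b) 1. $\mathrm{Out}\,K\cong\mathrm{Out}_0K\rtimes\mathrm{Out}\,X$, and the group $\mathrm{Out}_0K$ contains a normal subgroup $F$ such that $F\cong\Psi/\Psi_0$ and $(\mathrm{Out}_0K)/F\cong\Omega_1/\mathrm{In}(\mathrm{Aut}\,L)$. 2. If $\Psi=\Psi_0$, then $\mathrm{Out}\,K\cong\Omega_1/\mathrm{In}(\mathrm{Aut}\,L)\rtimes\mathrm{Out}\,X$. 3. If $\Omega_1=\mathrm{In}(\mathrm{Aut}\,L)$, then $\mathrm{Out}\,K\cong\Psi/\Psi_0\rtimes\mathrm{Out}\,X$. (In semidirect products the left factor is normal.)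
   Context: Rings are associative with nonzero identity. $T$ is a commutative ring, $R$ a $T$-algebra, $(X,\le)$ a preordered set (reflexive, transitive relation) which is locally finite: every interval $[x,y]=\{z: x\le z\le y\}$ is finite. Write $x\sim y$ iff $x\le y$ and $y\le x$; $[x]$ is the $\sim$-class of $x$, $\overline X=X/\!\sim$ the induced partially ordered set. $K=I(X,R)$ is the $T$-algebra of functions $f:X\times X\to R$ with $f(x,y)=0$ if $x\not\le y$, with pointwise addition and $T$-action and product $(fg)(x,y)=\sum_{x\le z\le y}f(x,z)g(z,y)$. Put $L=\{f\in K: f(x,y)=0 \text{ if } x\not\sim y\}$ (a subalgebra) and $M=\{f\in K: f(x,y)=0\text{ if }x\sim y\}$ (an ideal), so $K=L\oplus M$. For a class $[x]$, the idempotent $e_x\in L$ has $e_x(t,t)=1$ for $t\in[x]$ and all other values $0$; $R_x=e_xKe_x=e_xLe_x\cong M(n_x,R)$ with $n_x=|[x]|$, and $L=\prod R_x$ over the classes $[x]$. Isomorphisms of rings are isomorphisms of $T$-algebras. Condition (II): for every $T$-algebra automorphism $\varphi$ of $K$ and every $x\in X$ there is $y\in X$ with $\varphi(e_x)\in e_y+M$. Under Condition (II), $\varphi(M)=M$ for every $\varphi\in\mathrm{Aut}\,K$, so $\varphi$ has the form $\varphi(a+b)=\alpha(a)+(\delta(a)+\beta(b))$ ($a\in L,b\in M$) with $T$-linear $\alpha:L\to L$, $\delta:L\to M$, $\beta:M\to M$, where $\alpha\in\mathrm{Aut}\,L$. Notation: $\mathrm{Aut}$ is the group of $T$-algebra automorphisms,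 $\mathrm{In}(\mathrm{Aut}\,\cdot)$ the subgroup of inner automorphisms $a\mapsto v^{-1}av$, $\mathrm{Out}\,K=\mathrm{Aut}\,K/\mathrm{In}(\mathrm{Aut}\,K)$. $\mathrm{In}_1(\mathrm{Aut}\,K)$: inner automorphisms defined by elements $1+d$, $d\in M$ (always invertible). $\mathrm{In}_0(\mathrm{Aut}\,K)$: inner automorphisms of $K$ defined by invertible elements of $L$. $f:\mathrm{Aut}\,K\to\mathrm{Aut}\,L$, $f(\varphi)=\alpha$; $\Omega=\mathrm{Im}\,f$; $\Omega_1=\{\alpha\in\Omega:\alpha R_x=R_x\ \forall x\in X\}$. $\Lambda$: automorphisms with $\delta=0$. $C$: those $\varphi\in\Lambda$ with $\alpha R_x=R_x$ for all $x$. $\mathrm{Out}_0K=C/\mathrm{In}_0(\mathrm{Aut}\,K)$. $\Psi$: automorphisms with $\alpha=1$, $\delta=0$. $\Psi_0$: inner automorphisms of $K$ defined by invertible central elements of $L$. The group $\mathrm{Out}\,X$: $\mathrm{In}(\mathrm{Aut}\,X)$ is the normal subgroup of those order automorphisms of $X$ mapping each class $[x]$ onto itself; $\mathrm{Out}\,X=\mathrm{Aut}\,X/\mathrm{In}(\mathrm{Aut}\,X)$. It is isomorphic to $G=\{q\in\mathrm{Aut}\,\overline X:\ |q([x])|=|[x]|\ \forall x\}$ and is identified with a subgroup of $\mathrm{Aut}\,X$ complementing $\mathrm{In}(\mathrm{Aut}\,X)$ as follows: for each family of classes of the same cardinality fix a class $[z]$ and bijections $\varepsilon_{[x],[z]}:[z]\to[x]$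 with $\varepsilon_{[z],[z]}=\mathrm{id}$, put $\varepsilon_{[x],[y]}=\varepsilon_{[x],[z]}\varepsilon_{[y],[z]}^{-1}$, and for $q\in G$ let $\tau_q\in\mathrm{Aut}\,X$ act on each $[x]$ as $\varepsilon_{q([x]),[x]}$; then $\mathrm{Out}\,X$ is identified with $\{\tau_q:q\in G\}$. $\mathrm{Aut}\,X$ is embedded into $\mathrm{Aut}\,K$ by $\tau\mapsto\xi_\tau$, $\xi_\tau(g)(x,y)=g(\tau^{-1}(x),\tau^{-1}(y))$. Thus $\mathrm{Out}\,X\subseteq\Lambda\subseteq\mathrm{Aut}\,K$; the restriction of $f$ to $\mathrm{Out}\,X$ is injective, and by it $\mathrm{Out}\,X$ is also regarded as a subgroup of $\Omega$. *)

(* Defs.v *)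
From HB Require Import structures.
From mathcomp Require Import all_boot all_order all_algebra.
From mathcomp Require Import generic_quotient finmap.
From mathcomp Require Import mathcomp_extra boolp classical_sets functions.
From mathcomp Require Import cardinality.

Set Implicit Arguments.
Unset Strict Implicit.
Unset Printing Implicit Defensive.

Import Order.TTheory GRing.Theory.
Local Open Scope classical_set_scope.

Section Groups.
Local Open Scope group_scope.
Implicit Types G H : groupType.

Definition is_subgroup G (A : set G) :=
  [/\ A 1, forall x y, A x -> A y -> A (x * y) & forall x, A x -> A x^-1].

Record subgroup G := Subgroup {
  sgset :> set G;
  sgsetP : is_subgroup sgset }.

Definition normaliser G (N : set G) : set G :=
  [set g | forall x, N (x ^ g) <-> N x].

Definition normal_in G (N A : set G) := N `<=` A /\ A `<=` normaliser N.

Definition set_mulg G (A B : set G) : set G := [set x * y | x in A & y in B].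

Definition lcoset G (g : G) (N : set G) : set G := [set g * n | n in N].

(* As in fingroup: the ambient group of all quotients by N is N_G(N)/N, whose *)
(* elements are cosets, multiplied as sets.                                   *)
Section CosetOf.
Variables (G : groupType) (N : subgroup G).

Definition is_coset : pred (set G) :=
  fun c => `[< exists2 g, normaliser N g & c = lcoset g N >].

Record coset_of := Coset { cosetval :> set G; _ : is_coset cosetval }.
HB.instance Definition _ := [isSub for cosetval].
HB.instance Definition _ := [Choice of coset_of by <:].

Lemma normaliser1 : normaliser N 1.
Proof. by move=> x; rewrite conjg1. Qed.

Lemma normaliserM x y :
  normaliser N x -> normaliser N y -> normaliser N (x * y).
Proof. by move=> Nx Ny z; rewrite conjgM Ny Nx. Qed.

Lemma normaliserV x : normaliser N x -> normaliser N x^-1.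
Proof. by move=> Nx z; rewrite -Nx conjgKV. Qed.

Lemma lcosetE g x : lcoset g N x <-> sgset N (g^-1 * x).
Proof.
split=> [[n Nn <-]|Nx]; first by rewrite mulKg.
by exists (g^-1 * x) => //; rewrite mulVKg.
Qed.

Lemma set_mulg_lcoset g h : normaliser N h ->
  set_mulg (lcoset g N) (lcoset h N) = lcoset (g * h) N.
Proof.
move=> Nh; have [N1 NM NV] := sgsetP N.
apply/seteqP; split=> z /=.
- move=> [_ [m Nm <-]] [_ [n Nn <-]] <-.
  apply/lcosetE; have -> : (g * h)^-1 * (g * m * (h * n)) = m ^ h * n.
    by rewrite invgM conjgE -!mulgA mulKg.
  by apply: NM => //; apply/Nh.
- move=> [n Nn <-]; exists g; first by exists 1; rewrite ?mulg1.
  by exists (h * n); [exists n | rewrite mulgA].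
Qed.

Lemma set_invg_lcoset g : normaliser N g ->
  [set x^-1 | x in lcoset g N] = lcoset g^-1 N.
Proof.
move=> Ng; have [N1 NM NV] := sgsetP N.
apply/seteqP; split=> z /=.
- move=> [_ [n Nn <-] <-]; apply/lcosetE.
  have -> : g^-1^-1 * (g * n)^-1 = n^-1 ^ g^-1.
    by rewrite invgM conjgE !invgK.
  by apply/(normaliserV Ng)/NV.
- move=> [n Nn <-]; exists (n^-1 * g); last by rewrite invgM invgK.
  apply/lcosetE; rewrite -conjgE; apply/Ng; exact: NV.
Qed.

Fact coset1_proof : is_coset (lcoset 1 N).
Proof. by apply/asboolP; exists 1 => //; exact: normaliser1. Qed.

Lemma coset_ofP (c : coset_of) :
  exists2 g, normaliser N g & c = lcoset g N :> set G.
Proof. by case: c => c /= /asboolP. Qed.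

Fact cosetM_proof (c d : coset_of) : is_coset (set_mulg c d).
Proof.
have [[g Ng ->] [h Nh ->]] := (coset_ofP c, coset_ofP d).
apply/asboolP; exists (g * h); first exact: normaliserM.
exact: set_mulg_lcoset.
Qed.

Fact cosetV_proof (c : coset_of) : is_coset [set x^-1 | x in c].
Proof.
have [g Ng ->] := coset_ofP c.
apply/asboolP; exists g^-1; first exact: normaliserV.
exact: set_invg_lcoset.
Qed.

Definition coset1 := Coset coset1_proof.
Definition cosetM c d := Coset (cosetM_proof c d).
Definition cosetV c := Coset (cosetV_proof c).

Fact cosetMA : associative cosetM.
Proof.
move=> b c d; have [f Nf eb] := coset_ofP b; have [g Ng ec] := coset_ofP c.
have [h Nh ed] := coset_ofP d; apply: val_inj => /=; rewrite eb ec ed.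
by rewrite !set_mulg_lcoset ?mulgA //; exact: normaliserM.
Qed.

Fact coset1M : left_id coset1 cosetM.
Proof.
move=> c; have [g Ng ec] := coset_ofP c; apply: val_inj => /=.
by rewrite ec set_mulg_lcoset // mul1g.
Qed.

Fact cosetM1 : right_id coset1 cosetM.
Proof.
move=> c; have [g Ng ec] := coset_ofP c; apply: val_inj => /=.
by rewrite ec set_mulg_lcoset ?mulg1 //; exact: normaliser1.
Qed.

Fact cosetVM : left_inverse coset1 cosetV cosetM.
Proof.
move=> c; have [g Ng ec] := coset_ofP c; apply: val_inj => /=.
by rewrite ec set_invg_lcoset // set_mulg_lcoset // mulVg.
Qed.

Fact cosetMV : right_inverse coset1 cosetV cosetM.
Proof.
move=> c; have [g Ng ec] := coset_ofP c; apply: val_inj => /=.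
rewrite ec set_invg_lcoset // set_mulg_lcoset ?mulgV //.
exact: normaliserV.
Qed.

HB.instance Definition _ :=
  isGroup.Build coset_of cosetMA coset1M cosetM1 cosetVM cosetMV.

(* equal to gN if g normalises N, and to 1 otherwise *)
Definition coset (g : G) : coset_of := insubd (1 : coset_of) (lcoset g N).

(* the action of N_G(N) on N_G(N)/N induced by the conjugation n |-> h n h^-1 *)
Definition coset_conj (h : G) (c : coset_of) : coset_of :=
  coset h * c * (coset h)^-1.

End CosetOf.

Arguments coset {G} N g.

Definition quotient G (A : set G) (N : subgroup G) : set (coset_of N) :=
  coset N @` A.

Definition is_isom G H (A : set G) (B : set H) (f : G -> H) :=
  set_bij A B f /\ (forall x y, A x -> A y -> f (x * y) = f x * f y).

Definition isog G H (A : set G) (B : set H) :=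
  exists f : G -> H, is_isom A B f.

Definition is_sdprod G (D N H : set G) :=
  [/\ is_subgroup N, is_subgroup H, normal_in N D,
      N `&` H = [set 1] & set_mulg N H = D].

(* D = A ><| B ><| C does not depend on the bracketing: both are required. *)
Definition is_sdprod3 G (D A B C : set G) :=
  (is_sdprod (set_mulg A B) A B /\ is_sdprod D (set_mulg A B) C) /\
  (is_sdprod (set_mulg B C) B C /\ is_sdprod D A (set_mulg B C)).

Definition acts_by_autos G H (Q : set H) (N : set G) (act : H -> G -> G) :=
  [/\ forall q, Q q -> is_isom N N (act q),
      forall n, N n -> act 1 n = n &
      forall p q n, Q p -> Q q -> N n -> act (p * q) n = act p (act q n)].

(* D is isomorphic to the external semidirect product of N by Q for act *)
Definition isog_sdprod G1 G2 H (D : set G2) (N : set G1) (Q : set H)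
    (act : H -> G1 -> G1) :=
  acts_by_autos Q N act /\
  exists f : G1 * H -> G2,
    set_bij (N `*` Q) D f /\
    forall n q n' q', N n -> Q q -> N n' -> Q q' ->
      f (n * act q n', q * q') = f (n, q) * f (n', q').

End Groups.

Arguments quotient {G} A N _.
Arguments coset_conj {G} N h c.

Section AlgAut.
Local Open Scope ring_scope.
Variables (T : comNzRingType) (A : algType T).

Definition is_algaut : pred (A -> A) :=
  fun f => `[< [/\ bijective f, linear f & monoid_morphism f] >].

Record algaut := AlgAut { algaut_fun :> A -> A; _ : is_algaut algaut_fun }.
HB.instance Definition _ := [isSub for algaut_fun].
HB.instance Definition _ := [Choice of algaut by <:].

Lemma algautP (f : algaut) : [/\ bijective f, linear f & monoid_morphism f].
Proof. by case: f => f /= /asboolP. Qed.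

Fact algaut1_proof : is_algaut id.
Proof. by apply/asboolP; split=> //; exists id. Qed.

Fact algautM_proof (f g : algaut) : is_algaut (f \o g).
Proof.
have [bf lf [f1 fM]] := algautP f; have [bg lg [g1 gM]] := algautP g.
apply/asboolP; split; first exact: bij_comp.
  by move=> a u v /=; rewrite lg lf.
by split=> [|u v] /=; rewrite ?g1 ?f1 ?gM ?fM.
Qed.

Fact algautV_exists (f : algaut) : exists g, cancel f g /\ cancel g f.
Proof. by have [[g fK gK] _ _] := algautP f; exists g. Qed.

Definition algautV_fun (f : algaut) : A -> A := projT1 (cid (algautV_exists f)).

Lemma algautK (f : algaut) : cancel f (algautV_fun f).
Proof. by rewrite /algautV_fun; case: cid => g []. Qed.

Lemma algautKV (f : algaut) : cancel (algautV_fun f) f.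
Proof. by rewrite /algautV_fun; case: cid => g []. Qed.

Fact algautV_proof (f : algaut) : is_algaut (algautV_fun f).
Proof.
have [bf lf [f1 fM]] := algautP f.
have fI : injective f := can_inj (algautK f).
apply/asboolP; split.
- by exists f; [exact: algautKV | exact: algautK].
- by move=> a u v; apply: fI; rewrite lf !algautKV.
- by split=> [|u v]; apply: fI; rewrite ?f1 ?fM !algautKV.
Qed.

Definition algaut1 := AlgAut algaut1_proof.
Definition algautM f g := AlgAut (algautM_proof f g).
Definition algautV f := AlgAut (algautV_proof f).

Fact algautMA : associative algautM.
Proof. by move=> f g h; apply: val_inj. Qed.
Fact algaut1M : left_id algaut1 algautM.
Proof. by move=> f; apply: val_inj. Qed.
Fact algautM1 : right_id algaut1 algautM.
Proof. by move=> f; apply: val_inj. Qed.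
Fact algautVM : left_inverse algaut1 algautV algautM.
Proof. by move=> f; apply/val_inj/funext => a /=; rewrite algautK. Qed.
Fact algautMV : right_inverse algaut1 algautV algautM.
Proof. by move=> f; apply/val_inj/funext => a /=; rewrite algautKV. Qed.

HB.instance Definition _ :=
  isGroup.Build algaut algautMA algaut1M algautM1 algautVM algautMV.

Definition invertible (v : A) := exists w, v * w = 1 /\ w * v = 1.

(* f a = v^-1 a v for all a *)
Definition inner_by (v : A) (f : algaut) :=
  exists w, [/\ v * w = 1, w * v = 1 & forall a, f a = w * a * v].

Definition inner : set algaut := [set f | exists v, inner_by v f].

Lemma inner_by1 : inner_by 1 1%g.
Proof. by exists 1; split=> [||a]; rewrite ?mul1r ?mulr1. Qed.

Lemma inner_byM u v f g : inner_by u f -> inner_by v g ->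
  inner_by (v * u) (f * g)%g.
Proof.
move=> [u' [uu' u'u fE]] [v' [vv' v'v gE]]; exists (u' * v'); split=> [||a].
- by rewrite -mulrA (mulrA u) uu' mul1r.
- by rewrite -mulrA (mulrA v') v'v mul1r.
- by rewrite [LHS]fE gE !mulrA.
Qed.

Lemma inner_byV u u' f : u * u' = 1 -> u' * u = 1 -> inner_by u f ->
  inner_by u' (f^-1)%g.
Proof.
move=> uu' u'u [w [uw wu fE]]; exists u; split=> // a.
have -> : u' = w by rewrite -[u']mulr1 -uw mulrA u'u mul1r.
apply: (can_inj (algautK f)); rewrite [LHS]algautKV fE.
by rewrite !mulrA wu mul1r -mulrA wu mulr1.
Qed.

Fact inner_subgroup : is_subgroup inner.
Proof.
split; first by exists 1; exact: inner_by1.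
  by move=> f g [u fu] [v gv]; exists (v * u); exact: inner_byM.
move=> f [u fu]; have [w [uw wu _]] := fu.
by exists w; exact: inner_byV fu.
Qed.

Definition In_Aut := Subgroup inner_subgroup.

Definition corner (e : A) : set A := [set e * a * e | a in setT].

(* isomorphism of the T-algebras eAe and e'Ae', with identities e and e' *)
Definition corner_iso (e e' : A) :=
  exists f : A -> A,
    [/\ set_bij (corner e) (corner e') f,
        forall t a b, corner e a -> corner e b ->
          f (t *: a + b) = t *: f a + f b,
        forall a b, corner e a -> corner e b -> f (a * b) = f a * f b &
        f e = e'].

End AlgAut.

Arguments inner {T} A.
Arguments In_Aut {T} A.

(* The T-action on M(n,R) is entrywise; the lmodType instance of 'M[R]_n is   *)
(* over R, so T-linearity is spelled out.                                     *)
Definition matrix_alg_iso (T : comNzRingType) (R : algType T) (n m : nat) :=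
  exists f : {rmorphism 'M[R]_n -> 'M[R]_m},
    bijective f /\
    forall (t : T) (A : 'M[R]_n),
      f (map_mx (fun r => t *: r)%R A) = map_mx (fun r => t *: r)%R (f A).

Section OrdAut.
Local Open Scope order_scope.
Variables (d : Order.disp_t) (X : preorderType d).

Definition is_ordaut : pred (X -> X) :=
  fun f => `[< bijective f /\ {mono f : x y / x <= y} >].

Record ordaut := OrdAut { ordaut_fun :> X -> X; _ : is_ordaut ordaut_fun }.
HB.instance Definition _ := [isSub for ordaut_fun].
HB.instance Definition _ := [Choice of ordaut by <:].

Lemma ordautP (f : ordaut) : bijective f /\ {mono f : x y / x <= y}.
Proof. by case: f => f /= /asboolP. Qed.

Fact ordaut1_proof : is_ordaut id.
Proof. by apply/asboolP; split=> //; exists id. Qed.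

Fact ordautM_proof (f g : ordaut) : is_ordaut (f \o g).
Proof.
have [bf mf] := ordautP f; have [bg mg] := ordautP g.
apply/asboolP; split; first exact: bij_comp.
by move=> x y /=; rewrite mf mg.
Qed.

Fact ordautV_exists (f : ordaut) : exists g, cancel f g /\ cancel g f.
Proof. by have [[g fK gK] _] := ordautP f; exists g. Qed.

Definition ordautV_fun (f : ordaut) : X -> X := projT1 (cid (ordautV_exists f)).

Lemma ordautK (f : ordaut) : cancel f (ordautV_fun f).
Proof. by rewrite /ordautV_fun; case: cid => g []. Qed.

Lemma ordautKV (f : ordaut) : cancel (ordautV_fun f) f.
Proof. by rewrite /ordautV_fun; case: cid => g []. Qed.

Fact ordautV_proof (f : ordaut) : is_ordaut (ordautV_fun f).
Proof.
have [bf mf] := ordautP f; apply/asboolP; split.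
  by exists f; [exact: ordautKV | exact: ordautK].
by move=> x y; rewrite -mf !ordautKV.
Qed.

Definition ordaut1 := OrdAut ordaut1_proof.
Definition ordautM f g := OrdAut (ordautM_proof f g).
Definition ordautV f := OrdAut (ordautV_proof f).

Fact ordautMA : associative ordautM.
Proof. by move=> f g h; apply: val_inj. Qed.
Fact ordaut1M : left_id ordaut1 ordautM.
Proof. by move=> f; apply: val_inj. Qed.
Fact ordautM1 : right_id ordaut1 ordautM.
Proof. by move=> f; apply: val_inj. Qed.
Fact ordautVM : left_inverse ordaut1 ordautV ordautM.
Proof. by move=> f; apply/val_inj/funext => a /=; rewrite ordautK. Qed.
Fact ordautMV : right_inverse ordaut1 ordautV ordautM.
Proof. by move=> f; apply/val_inj/funext => a /=; rewrite ordautKV. Qed.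

HB.instance Definition _ :=
  isGroup.Build ordaut ordautMA ordaut1M ordautM1 ordautVM ordautMV.

End OrdAut.

(* Nonemptiness is what makes 1 <> 0 in the incidence algebra. *)
HB.mixin Record isLocallyFinite (d : Order.disp_t) X of Order.Preorder d X := {
  itv_finite : forall x y : X, finite_set [set z : X | (x <= z <= y)%O];
  itv_inhabited : inhabited X }.

#[short(type="locFinPreorderType")]
HB.structure Definition LocFinPreorder (d : Order.disp_t) :=
  {X of Order.Preorder d X & isLocallyFinite d X}.

Section Classes.
Local Open Scope order_scope.
Local Open Scope quotient_scope.
Variables (d : Order.disp_t) (X : locFinPreorderType d).

Definition sim (x y : X) : bool := (x <= y) && (y <= x).

Fact sim_equiv : equiv_class_of sim.
Proof.
apply: EquivClass => [x|x y|y x z]; rewrite /sim ?lexx //.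
  exact: andbC.
move=> /andP[xy yx] /andP[yz zy].
by rewrite (le_trans xy yz) (le_trans zy yx).
Qed.

Canonical sim_equivRel := EquivRelPack sim_equiv.

(* the induced partially ordered set; its elements are the classes *)
Definition Xbar := {eq_quot sim}.
HB.instance Definition _ := Choice.on Xbar.
HB.instance Definition _ := Quotient.on Xbar.
HB.instance Definition _ := EqQuotient.on Xbar.

Definition cls (x : X) : Xbar := \pi_Xbar x.

Definition le_bar (u v : Xbar) : bool := repr u <= repr v.

Lemma clsP x y : (cls x == cls y) = sim x y.
Proof. by rewrite /cls eqmodE. Qed.

Lemma sim_repr x : sim (repr (cls x)) x.
Proof. by rewrite -clsP /cls reprK. Qed.

Lemma le_barE x y : le_bar (cls x) (cls y) = (x <= y).
Proof.
have /andP[x1 x2] := sim_repr x; have /andP[y1 y2] := sim_repr y.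
rewrite /le_bar; apply/idP/idP => h.
  exact: le_trans x2 (le_trans h y1).
exact: le_trans x1 (le_trans h y2).
Qed.

Fact le_bar_refl : reflexive le_bar.
Proof. by move=> u; exact: lexx. Qed.
Fact le_bar_anti : antisymmetric le_bar.
Proof.
by move=> u v h; rewrite -(reprK u) -(reprK v); apply/eqP; rewrite clsP.
Qed.
Fact le_bar_trans : transitive le_bar.
Proof. by move=> v u w; exact: le_trans. Qed.

HB.instance Definition _ :=
  Order.Le_isPOrder.Build d Xbar le_bar_refl le_bar_anti le_bar_trans.

Definition class_set (u : Xbar) : set X := [set x | cls x = u].

(* classes are finite, being intervals [x, x] *)
Lemma class_set_finite u : finite_set (class_set u).
Proof.
have := itv_finite (repr u) (repr u); apply: sub_finite_set => x /= xu.
by have := sim_repr x; rewrite xu.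
Qed.

Definition class_card (u : Xbar) : nat := #|` fset_set (class_set u)|%fset.

(* [cb_rep u] is the chosen class z of the same cardinality as u, and         *)
(* [cb_fun u] is the bijection eps_{u,z} : z -> u.                            *)
Record class_bijections := ClassBijections {
  cb_rep : Xbar -> Xbar;
  cb_fun : Xbar -> X -> X;
  cb_rep_card : forall u, class_card (cb_rep u) = class_card u;
  cb_rep_eq : forall u v, class_card u = class_card v -> cb_rep u = cb_rep v;
  cb_fun_bij : forall u, set_bij (class_set (cb_rep u)) (class_set u) (cb_fun u);
  cb_fun_id : forall u x, class_set (cb_rep u) x -> cb_fun (cb_rep u) x = x }.

Variable eps : class_bijections.

(* eps_{u,v} = eps_{u,z} o eps_{v,z}^-1 *)
Definition cb_trans (u v : Xbar) (x : X) : X :=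
  cb_fun eps u ('pinv_id (class_set (cb_rep eps v)) (cb_fun eps v) x).

Definition card_preserving : set (ordaut Xbar) :=
  [set q | forall u, class_card (q u) = class_card u].

Definition Out_X : set (ordaut X) :=
  [set tau | exists2 q, card_preserving q &
    forall x, tau x = cb_trans (q (cls x)) (cls x) x].

End Classes.

Section Incidence.
Local Open Scope ring_scope.
Variables (d : Order.disp_t) (X : locFinPreorderType d).
Variables (T : comNzRingType) (R : algType T).

Definition itv (x y : X) : {fset X} := fset_set [set z : X | (x <= z <= y)%O].

Lemma in_itv x y z : (z \in itv x y) = (x <= z <= y)%O.
Proof.
by rewrite in_fset_set; [apply/idP/idP; rewrite inE | exact: itv_finite].
Qed.

Definition is_incidence : pred (X -> X -> R) :=
  fun f => `[< forall x y, ~~ (x <= y)%O -> f x y = 0 >].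

Record incidence := Incidence {
  inc_fun :> X -> X -> R;
  _ : is_incidence inc_fun }.
HB.instance Definition _ := [isSub for inc_fun].
HB.instance Definition _ := [Choice of incidence by <:].

Lemma inc0 (f : incidence) x y : ~~ (x <= y)%O -> f x y = 0.
Proof. by case: f => f /= /asboolP; apply. Qed.

Lemma incP (f g : incidence) : (forall x y, f x y = g x y) -> f = g.
Proof. by move=> fg; apply/val_inj/funext => x; apply/funext => y. Qed.

Fact inc_zero_proof : is_incidence (fun _ _ => 0).
Proof. exact/asboolP. Qed.
Fact inc_add_proof (f g : incidence) : is_incidence (fun x y => f x y + g x y).
Proof. by apply/asboolP => x y xy; rewrite !inc0 ?addr0. Qed.
Fact inc_opp_proof (f : incidence) : is_incidence (fun x y => - f x y).
Proof. by apply/asboolP => x y xy; rewrite inc0 ?oppr0. Qed.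
Fact inc_scale_proof (t : T) (f : incidence) :
  is_incidence (fun x y => t *: f x y).
Proof. by apply/asboolP => x y xy; rewrite inc0 ?scaler0. Qed.
Fact inc_one_proof : is_incidence (fun x y => (x == y)%:R).
Proof.
apply/asboolP => x y; case: eqVneq => // -> .
by rewrite lexx.
Qed.
Fact inc_mul_proof (f g : incidence) :
  is_incidence (fun x y => \sum_(z <- itv x y) f x z * g z y).
Proof.
apply/asboolP => x y xy; rewrite big_seq big1 // => z.
by rewrite in_itv => /andP[xz zy]; rewrite (le_trans xz zy) in xy.
Qed.

Definition inc_zero := Incidence inc_zero_proof.
Definition inc_add f g := Incidence (inc_add_proof f g).
Definition inc_opp f := Incidence (inc_opp_proof f).
Definition inc_scale t f := Incidence (inc_scale_proof t f).
Definition inc_one := Incidence inc_one_proof.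
Definition inc_mul f g := Incidence (inc_mul_proof f g).

Fact inc_addA : associative inc_add.
Proof. by move=> f g h; apply: incP => x y /=; rewrite addrA. Qed.
Fact inc_addC : commutative inc_add.
Proof. by move=> f g; apply: incP => x y /=; rewrite addrC. Qed.
Fact inc_add0 : left_id inc_zero inc_add.
Proof. by move=> f; apply: incP => x y /=; rewrite add0r. Qed.
Fact inc_addN : left_inverse inc_zero inc_opp inc_add.
Proof. by move=> f; apply: incP => x y /=; rewrite addNr. Qed.

HB.instance Definition _ :=
  GRing.isZmodule.Build incidence inc_addA inc_addC inc_add0 inc_addN.

Lemma inc_mul_widen (f g : incidence) x y (A : {fset X}) :
  {subset itv x y <= A} ->
  \sum_(z <- itv x y) f x z * g z y = \sum_(z <- A) f x z * g z y.
Proof.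
move=> sA; rewrite [RHS](bigID (mem (itv x y))) /= [X in _ + X]big1 ?addr0.
  rewrite -[RHS]big_filter; apply/perm_big/uniq_perm.
  - exact: fset_uniq.
  - exact/filter_uniq/fset_uniq.
  - move=> z; rewrite mem_filter; case: (boolP (z \in itv x y)) => //= zi.
    by rewrite sA.
move=> z; rewrite in_itv negb_and => /orP[xz|zy].
  by rewrite inc0 ?mul0r.
by rewrite (inc0 g) ?mulr0.
Qed.

Fact inc_mulA : associative inc_mul.
Proof.
move=> f g h; apply: incP => x y /=.
transitivity (\sum_(z <- itv x y) \sum_(w <- itv x y)
    f x z * (g z w * h w y)).
  apply: eq_big_seq => z; rewrite in_itv => /andP[xz zy].
  rewrite -mulr_sumr; congr (_ * _); apply: inc_mul_widen => w.
  by rewrite !in_itv => /andP[zw ->]; rewrite (le_trans xz zw).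
rewrite exchange_big; apply: eq_big_seq => w; rewrite in_itv => /andP[xw wy].
rewrite (@inc_mul_widen f g x w (itv x y)).
  by rewrite mulr_suml; apply: eq_bigr => z _; rewrite mulrA.
by move=> z; rewrite !in_itv => /andP[-> zw]; rewrite (le_trans zw wy).
Qed.

Lemma itv_l (x y : X) : (x <= y)%O -> x \in itv x y.
Proof. by move=> xy; rewrite in_itv lexx. Qed.
Lemma itv_r (x y : X) : (x <= y)%O -> y \in itv x y.
Proof. by move=> xy; rewrite in_itv lexx andbT. Qed.

Fact inc_mul1l : left_id inc_one inc_mul.
Proof.
move=> f; apply: incP => x y /=; case: (boolP (x <= y)%O) => xy; last first.
  by rewrite inc0 // big_seq big1 // => z; rewrite in_itv => /andP[xz zy];
     rewrite (le_trans xz zy) in xy.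
rewrite (big_fsetD1 x) ?itv_l //= eqxx mul1r big_seq big1 ?addr0 // => z.
by rewrite in_fsetD1 eq_sym => /andP[/negPf -> _]; rewrite mul0r.
Qed.
Fact inc_mul1r : right_id inc_one inc_mul.
Proof.
move=> f; apply: incP => x y /=; case: (boolP (x <= y)%O) => xy; last first.
  by rewrite inc0 // big_seq big1 // => z; rewrite in_itv => /andP[xz zy];
     rewrite (le_trans xz zy) in xy.
rewrite (big_fsetD1 y) ?itv_r //= eqxx mulr1 big_seq big1 ?addr0 // => z.
by rewrite in_fsetD1 => /andP[/negPf -> _]; rewrite mulr0.
Qed.
Fact inc_mulDl : left_distributive inc_mul inc_add.
Proof.
move=> f g h; apply: incP => x y /=; rewrite -big_split /=.
by apply: eq_bigr => z _; rewrite mulrDl.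
Qed.
Fact inc_mulDr : right_distributive inc_mul inc_add.
Proof.
move=> f g h; apply: incP => x y /=; rewrite -big_split /=.
by apply: eq_bigr => z _; rewrite mulrDr.
Qed.
Fact inc_one_neq0 : inc_one != 0.
Proof.
have [x] := @itv_inhabited d X; apply/eqP => /(congr1 (fun f : incidence => f x x)).
by move/eqP; rewrite /= eqxx oner_eq0.
Qed.

HB.instance Definition _ := GRing.Zmodule_isNzRing.Build incidence
  inc_mulA inc_mul1l inc_mul1r inc_mulDl inc_mulDr inc_one_neq0.

Fact inc_scaleA (a b : T) f :
  inc_scale a (inc_scale b f) = inc_scale (a * b) f.
Proof. by apply: incP => x y /=; rewrite scalerA. Qed.
Fact inc_scale1 : left_id 1 inc_scale.
Proof. by move=> f; apply: incP => x y /=; rewrite scale1r. Qed.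
Fact inc_scaleDr : right_distributive inc_scale +%R.
Proof. by move=> a f g; apply: incP => x y /=; rewrite scalerDr. Qed.
Fact inc_scaleDl f : {morph inc_scale^~ f : a b / a + b}.
Proof. by move=> a b; apply: incP => x y /=; rewrite scalerDl. Qed.

HB.instance Definition _ := GRing.Zmodule_isLmodule.Build T incidence
  inc_scaleA inc_scale1 inc_scaleDr inc_scaleDl.

Fact inc_scaleAl (a : T) (f g : incidence) : a *: (f * g) = a *: f * g.
Proof.
apply: incP => x y /=; rewrite scaler_sumr.
by apply: eq_bigr => z _; rewrite scalerAl.
Qed.
HB.instance Definition _ :=
  GRing.Lmodule_isLalgebra.Build T incidence inc_scaleAl.
Fact inc_scaleAr (a : T) (f g : incidence) : a *: (f * g) = f * (a *: g).
Proof.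
apply: incP => x y /=; rewrite scaler_sumr.
by apply: eq_bigr => z _; rewrite scalerAr.
Qed.
HB.instance Definition _ :=
  GRing.Lalgebra_isAlgebra.Build T incidence inc_scaleAr.

(* L consists of the block-diagonal elements; M is the complementary ideal.*)
Definition in_L : pred incidence :=
  fun f => `[< forall x y, ~~ sim x y -> f x y = 0 >].

Definition ideal_M : set incidence := [set f | forall x y, sim x y -> f x y = 0].

Fact in_L_closed : subalg_closed in_L.
Proof.
split=> [|a f g /asboolP f0 /asboolP g0|f g /asboolP f0 /asboolP g0];
  apply/asboolP => x y xy /=.
- by case: eqVneq xy => // ->; rewrite /sim lexx.
- by rewrite f0 ?g0 // scaler0 addr0.
- rewrite big_seq big1 // => z; rewrite in_itv => /andP[xz zy].
  case: (boolP (sim x z)) => [sxz|/f0 ->]; last by rewrite mul0r.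
  rewrite g0 ?mulr0 //; apply: contra xy => /andP[_ yz].
  by move: sxz => /andP[_ zx]; rewrite /sim (le_trans xz zy) (le_trans yz zx).
Qed.

Record blockdiag := BlockDiag { bd_inc :> incidence; bd_incP : in_L bd_inc }.
HB.instance Definition _ := [isSub for bd_inc].
HB.instance Definition _ := [Choice of blockdiag by <:].
HB.instance Definition _ :=
  GRing.SubChoice_isSubAlgebra.Build T incidence in_L blockdiag
    (GRing.subalg_closed_semi in_L_closed).


Local Notation K := incidence.
Local Notation L := blockdiag.

Fact projL_inc_proof (f : K) :
  is_incidence (fun x y => if sim x y then f x y else 0).
Proof. by apply/asboolP => x y xy; rewrite inc0 // if_same. Qed.
Fact projL_proof (f : K) : in_L (Incidence (projL_inc_proof f)).
Proof. by apply/asboolP => x y /negPf /= ->. Qed.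

Definition projL (f : K) : L := BlockDiag (projL_proof f).
Definition projM (f : K) : K := f - projL f.

Fact idem_inc_proof (c : Xbar X) :
  is_incidence (fun x y => ((x == y) && (cls x == c))%:R : R).
Proof. by apply/asboolP => x y; case: eqVneq => // ->; rewrite lexx. Qed.
Fact idem_proof (c : Xbar X) : in_L (Incidence (idem_inc_proof c)).
Proof.
apply/asboolP => x y /=; case: eqVneq => // ->.
by rewrite /sim lexx.
Qed.

Definition idem (c : Xbar X) : L := BlockDiag (idem_proof c).

(* R_x = e_x K e_x = e_x L e_x, as a subset of L *)
Definition Rx (x : X) : set L := corner (idem (cls x)).

Definition condition_II := forall (phi : algaut K) (x : X),
  exists y : X, ideal_M (phi (idem (cls x)) - idem (cls y)).

(* phi (a + b) = alpha a + (delta a + beta b), for a in L and b in M *)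
Definition alpha (phi : algaut K) (a : L) : L := projL (phi a).
Definition delta (phi : algaut K) (a : L) : K := projM (phi a).

(* The image of S under f : Aut K -> Aut L, f phi = alpha phi; under          *)
(* Condition (II), every alpha phi is an automorphism of L.                   *)
Definition diag_image (S : set (algaut K)) : set (algaut L) :=
  [set a | exists2 phi, S phi & a = alpha phi :> (L -> L)].

Definition preserves_Rx (a : L -> L) := forall x, a @` Rx x = Rx x.

Definition Omega : set (algaut L) := diag_image setT.
Definition Omega1 : set (algaut L) := [set a | Omega a /\ preserves_Rx a].

Definition Lambda : set (algaut K) := [set phi | delta phi = cst 0].
Definition C : set (algaut K) :=
  [set phi | Lambda phi /\ preserves_Rx (alpha phi)].
Definition Psi : set (algaut K) :=
  [set phi | alpha phi = id /\ delta phi = cst 0].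

Definition In1 : set (algaut K) :=
  [set phi | exists2 b, ideal_M b & inner_by (1 + b) phi].
Definition inner0 : set (algaut K) :=
  [set phi | exists2 u : L, invertible u & inner_by (u : K) phi].
Definition central (u : L) := forall a : L, u * a = a * u.
Definition Psi0_set : set (algaut K) :=
  [set phi | exists u : L, [/\ invertible u, central u & inner_by (u : K) phi]].

Fact inner0_subgroup : is_subgroup inner0.
Proof.
split.
- exists 1; first by exists 1; rewrite mulr1.
  exact: inner_by1.
- move=> f g [u [u' [uu' u'u]] fu] [v [v' [vv' v'v]] gv].
  exists (v * u); last exact: inner_byM.
  exists (u' * v'); split.
    by rewrite -mulrA (mulrA u) uu' mul1r.
  by rewrite -mulrA (mulrA v') v'v mul1r.
- move=> f [u [u' [uu' u'u]] fu]; exists u'; first by exists u.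
  have vuu' : (u : K) * (u' : K) = 1 by have := congr1 val uu'.
  have vu'u : (u' : K) * (u : K) = 1 by have := congr1 val u'u.
  exact: inner_byV vuu' vu'u fu.
Qed.

Fact Psi0_subgroup : is_subgroup Psi0_set.
Proof.
split.
- exists 1; split; first by exists 1; rewrite mulr1.
    by move=> a; rewrite mul1r mulr1.
  exact: inner_by1.
- move=> f g [u [[u' [uu' u'u]] cu fu]] [v [[v' [vv' v'v]] cv gv]].
  exists (v * u); split; last exact: inner_byM.
    exists (u' * v'); split.
      by rewrite -mulrA (mulrA u) uu' mul1r.
    by rewrite -mulrA (mulrA v') v'v mul1r.
  by move=> a; rewrite -mulrA cu mulrA cv mulrA.
- move=> f [u [[u' [uu' u'u]] cu fu]]; exists u'; split; first by exists u.
    by move=> a; rewrite -[LHS]mulr1 -uu' !mulrA -(mulrA u') -cu mulrA u'u mul1r.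
  have vuu' : (u : K) * (u' : K) = 1 by have := congr1 val uu'.
  have vu'u : (u' : K) * (u : K) = 1 by have := congr1 val u'u.
  exact: inner_byV vuu' vu'u fu.
Qed.

Definition In0 : subgroup (algaut K) := Subgroup inner0_subgroup.
Definition Psi0 : subgroup (algaut K) := Subgroup Psi0_subgroup.

Definition Out_K : set (coset_of (In_Aut K)) :=
  quotient setT (In_Aut K).
Definition Out0_K : set (coset_of In0) := quotient C In0.

Lemma ordautVE (t : ordaut X) : cancel (t^-1)%g t * cancel t (t^-1)%g.
Proof. by split; [exact: ordautKV | exact: ordautK]. Qed.

Fact xi_inc_proof (t : ordaut X) (g : K) :
  is_incidence (fun x y => g ((t^-1)%g x) ((t^-1)%g y)).
Proof.
have [_ tm] := ordautP (t^-1)%g.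
by apply/asboolP => x y xy; rewrite inc0 // tm.
Qed.

Definition xi_fun (t : ordaut X) (g : K) : K := Incidence (xi_inc_proof t g).

Lemma xi_funE t g x y : xi_fun t g x y = g ((t^-1)%g x) ((t^-1)%g y).
Proof. by []. Qed.

Fact xi_proof (t : ordaut X) : is_algaut (xi_fun t).
Proof.
have [_ tm] := ordautP (t^-1)%g.
apply/asboolP; split.
- exists (xi_fun (t^-1)%g) => g; apply: incP => x y;
    by rewrite !xi_funE invgK ?(ordautVE t).1 ?(ordautVE t).2.
- by move=> a f g; apply: incP => x y.
- split=> [|f g]; apply: incP => x y /=.
    by rewrite (can_eq (ordautVE t).1).
  rewrite -(big_map (t^-1)%g xpredT (fun z =>
    f ((t^-1)%g x) z * g z ((t^-1)%g y))) /=.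
  apply/perm_big/uniq_perm.
  - exact: fset_uniq.
  - rewrite map_inj_uniq; first exact: fset_uniq.
    exact: can_inj (ordautVE t).1.
  - move=> z; rewrite in_itv -[z](ordautVE t).2 !tm mem_map.
      by rewrite in_itv.
    exact: can_inj (ordautVE t).1.
Qed.

Definition xi (t : ordaut X) : algaut K := AlgAut (xi_proof t).

(* Out X, identified with Out_X eps, as a subgroup of Aut K and of Omega *)
Definition OutX_K (eps : class_bijections X) : set (algaut K) := xi @` Out_X eps.
Definition OutX_L (eps : class_bijections X) : set (algaut L) :=
  diag_image (OutX_K eps).

End Incidence.

Arguments incidence {d} X {T} R.
Arguments blockdiag {d} X {T} R.
Arguments Rx {d X T} R x.
Arguments condition_II {d} X {T} R.
Arguments Omega {d} X {T} R.
Arguments Omega1 {d} X {T} R.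
Arguments Lambda {d} X {T} R.
Arguments C {d} X {T} R.
Arguments Psi {d} X {T} R.
Arguments In0 {d} X {T} R.
Arguments In1 {d} X {T} R.
Arguments Psi0 {d} X {T} R.
Arguments Out_K {d} X {T} R.
Arguments Out0_K {d} X {T} R.
Arguments idem {d X T} R c.
Arguments OutX_K {d X T} R eps.
Arguments OutX_L {d X T} R eps.

(* Main.v *)
From HB Require Import structures.
Require Import Defs.
From mathcomp Require Import all_boot all_order all_algebra.
From mathcomp Require Import finmap.
From mathcomp Require Import mathcomp_extra boolp classical_sets functions.
From mathcomp Require Import cardinality.

(** Under Condition (II) every automorphism phi of K preserves the ideal M, so
    it induces alpha(phi) in Aut L, and alpha(phi) permutes the idempotents e_x.
    Conjugating phi by the unipotent element v with v(s,t) =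
    phi(alpha(phi)^-1 e_[t])(s,t) makes it diagonal, whence
    Aut K = In_1 Lambda, with trivial intersection.  For a diagonal automorphism
    the permutation of the classes is an order automorphism, because x <= y iff
    e_x K e_y <> 0, and (1) or (2) makes it preserve the cardinalities, because
    R_x and R_{q(x)} are isomorphic; so it is also induced by a unique element
    of Out X, while the elements inducing the trivial permutation form Omega_1
    and C.  This gives (a).  Each isomorphism in (b) compares the images of two
    homomorphisms with a common kernel; the kernels are computed from
    In(Aut K) /\ Lambda = In_0(Aut K). *)

Set Implicit Arguments.
Unset Strict Implicit.
Unset Printing Implicit Defensive.

Import Order.TTheory GRing.Theory.
Local Open Scope classical_set_scope.

(** * Subgroups, cosets and semidirect products inside an ambient group *)

Section GroupTheory.
Local Open Scope group_scope.
Implicit Types G H : groupType.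

(** Multiplicativity is asked on S only, because [coset N] is in general a homomorphism on the
    normaliser of N and not on the whole group. *)
Definition morph_on G H (S : set G) (h : G -> H) :=
  forall x y, S x -> S y -> h (x * y) = h x * h y.

Lemma is_subgroupT G : is_subgroup (setT : set G).
Proof. by []. Qed.

Lemma normaliser_conj G (N : set G) :
  (forall g x, N x -> N (g * x * g^-1)) -> forall g, normaliser N g.
Proof.
move=> NN g x; rewrite conjgE; split=> Nx.
  have := NN g _ Nx.
  by rewrite !mulgA mulgV mul1g mulgK.
by have := NN g^-1 _ Nx; rewrite invgK mulgA.
Qed.

Lemma normaliser_conj_on G (D N : set G) : is_subgroup D ->
  (forall g x, D g -> N x -> N (g * x * g^-1)) -> D `<=` normaliser N.
Proof.
move=> [_ _ DV] NN g Dg x; rewrite conjgE; split=> Nx.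
  have := NN g _ Dg Nx.
  by rewrite !mulgA mulgV mul1g mulgK.
by have := NN g^-1 _ (DV _ Dg) Nx; rewrite invgK mulgA.
Qed.

Lemma normaliserJ G (N : set G) g x : normaliser N g -> N x -> N (g * x * g^-1).
Proof.
move=> Ng Nx; apply/Ng.
by rewrite conjgE !mulgA mulVg mul1g mulgVK.
Qed.

Section MorphOn.
Variables (G H : groupType) (S : set G) (h : G -> H).
Hypotheses (sgS : is_subgroup S) (hM : morph_on S h).

Lemma morph_on1 : h 1 = 1.
Proof.
have [S1 _ _] := sgS; apply: (mulgI (h 1)).
by rewrite -hM // !mulg1.
Qed.

Lemma morph_onV x : S x -> h x^-1 = (h x)^-1.
Proof.
move=> Sx; have [_ _ SV] := sgS; apply: (mulgI (h x)).
by rewrite -hM ?mulgV ?morph_on1 //; apply: SV.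
Qed.

Lemma morph_on_eq x y : S x -> S y -> h x = h y <-> h (x^-1 * y) = 1.
Proof.
move=> Sx Sy; have [_ _ SV] := sgS.
rewrite hM ?morph_onV //; last exact: SV.
split=> [->|e]; first by rewrite mulVg.
by apply: (mulgI (h x)^-1); rewrite mulVg e.
Qed.

Lemma is_subgroup_image : is_subgroup (h @` S).
Proof.
have [S1 SM SV] := sgS; split; first by exists 1; rewrite ?morph_on1.
- by move=> _ _ [x Sx <-] [y Sy <-]; exists (x * y); [exact: SM | rewrite hM].
- by move=> _ [x Sx <-]; exists x^-1; [exact: SV | rewrite morph_onV].
Qed.

End MorphOn.

(* The first isomorphism theorem in a symmetric form.                         *)
Lemma isog_images G H1 H2 (S : set G) (h1 : G -> H1) (h2 : G -> H2) :
  is_subgroup S -> morph_on S h1 -> morph_on S h2 ->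
  (forall x, S x -> h1 x = 1 <-> h2 x = 1) ->
  isog (h1 @` S) (h2 @` S).
Proof.
move=> sgS h1M h2M ker12; have [S1 SM SV] := sgS.
have eq12 x y : S x -> S y -> h1 x = h1 y <-> h2 x = h2 y.
  move=> Sx Sy; rewrite (morph_on_eq sgS h1M) // (morph_on_eq sgS h2M) //.
  by apply: ker12; apply: (SM) => //; apply: SV.
(* With the implication inside the existential, [choice] yields a total section of [h1]; off the
   image its value is arbitrary. *)
have preim y : exists x, (h1 @` S) y -> S x /\ h1 x = y.
  by have [[x Sx <-]|ny] := pselect ((h1 @` S) y); [exists x | exists 1].
have [p pP] := choice preim.
have pE x : S x -> h2 (p (h1 x)) = h2 x.
  move=> Sx; have [|Sp e] := pP (h1 x); first by exists x.
  exact/eq12.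
exists (h2 \o p); split; last first.
  by move=> _ _ [x Sx <-] [y Sy <-] /=; rewrite -h1M // !pE ?h2M //; apply: (SM).
split.
- by move=> _ [x Sx <-] /=; rewrite pE //; exists x.
- move=> _ _ /set_mem[x Sx <-] /set_mem[y Sy <-] /=.
  by rewrite !pE // => /(eq12 _ _ Sx Sy).
- by move=> _ [x Sx <-]; exists (h1 x); [exists x | rewrite /= pE].
Qed.

Section CosetTheory.
Variables (G : groupType) (N : subgroup G).

Lemma coset_lcoset g : normaliser N g -> coset N g = lcoset g N :> set G.
Proof.
move=> Ng; rewrite /coset -[LHS]/(val _) insubdK //.
by apply/asboolP; exists g.
Qed.

Lemma coset_morph : morph_on (normaliser N) (coset N).
Proof.
move=> g h Ng Nh; apply: val_inj => /=.
rewrite !coset_lcoset ?set_mulg_lcoset //.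
exact: normaliserM.
Qed.

Lemma coset_morph_on (S : set G) : S `<=` normaliser N -> morph_on S (coset N).
Proof. by move=> SN x y /SN Nx /SN Ny; exact: coset_morph. Qed.

Lemma normaliser_subgroup : is_subgroup (normaliser N).
Proof.
by split; [exact: normaliser1 | exact: normaliserM | exact: normaliserV].
Qed.

Lemma coset_id1 : coset N 1 = 1.
Proof. exact: morph_on1 normaliser_subgroup coset_morph. Qed.

Lemma coset_inv g : normaliser N g -> coset N g^-1 = (coset N g)^-1.
Proof. exact: morph_onV normaliser_subgroup coset_morph g. Qed.

Lemma coset_eq1 g : normaliser N g -> coset N g = 1 <-> sgset N g.
Proof.
move=> Ng; have [N1 _ NV] := sgsetP N.
split=> [/(congr1 (fun c : coset_of N => c : set G))|Nng].
  rewrite coset_lcoset //= => e.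
  have : lcoset g N g by exists 1 => //; rewrite mulg1.
  by rewrite e lcosetE invg1 mul1g.
apply: val_inj => /=; rewrite coset_lcoset //; apply/seteqP.
have [_ NM _] := sgsetP N.
split=> x /lcosetE Nx; apply/lcosetE.
  by rewrite invg1 mul1g -(mulVKg g x); apply: (NM).
by move: Nx; rewrite invg1 mul1g => Nx; apply: (NM) => //; apply: NV.
Qed.

Lemma coset_eq x y : normaliser N x -> normaliser N y ->
  coset N x = coset N y <-> sgset N (x^-1 * y).
Proof.
move=> Nx Ny; rewrite (morph_on_eq normaliser_subgroup coset_morph) //.
by apply: coset_eq1; apply: normaliserM => //; apply: normaliserV.
Qed.

End CosetTheory.

Lemma sdprod_intro G (D A H : set G) :
  is_subgroup D -> is_subgroup A -> is_subgroup H ->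
  normal_in A D -> H `<=` D ->
  (forall x, A x -> H x -> x = 1) ->
  (forall x, D x -> exists2 h, H h & A (x * h^-1)) ->
  is_sdprod D A H.
Proof.
move=> [_ DM _] sgA sgH [AD nA] HD AH DAH; split=> //.
  apply/seteqP; split=> x /=; first by case; exact: AH.
  by move=> ->; split; [case: sgA | case: sgH].
apply/seteqP; split=> x /=.
  by move=> [a Aa [h Hh <-]]; apply: DM; [exact: AD | exact: HD].
move=> /DAH[h Hh Axh]; exists (x * h^-1) => //; exists h => //.
by rewrite mulgVK.
Qed.

(** As N lies in A it meets H trivially, so H survives unchanged in D/N, and (aN, h) -> aN hN is the
    required isomorphism. *)
Lemma isog_sdprod_quotient G (D A H : set G) (N : subgroup G) :
  is_sdprod D A H -> N `<=` A -> D `<=` normaliser N ->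
  isog_sdprod (quotient D N) (quotient A N) H (coset_conj N).
Proof.
move=> [sgA sgH [AD nA] AH1 DE] NA nN.
have [A1 AM AV] := sgA; have [H1 HM HV] := sgH.
have HD : H `<=` D by rewrite -DE => h Hh; exists 1 => //; exists h; rewrite ?mul1g.
have nNA x : A x -> normaliser N x by move=> /AD/nN.
have nNH x : H x -> normaliser N x by move=> /HD/nN.
have conj_coset h a : H h -> A a ->
    coset_conj N h (coset N a) = coset N (h * a * h^-1).
  move=> Hh Aa; rewrite /coset_conj -coset_inv; last exact: nNH.
  rewrite -!coset_morph //; try by [exact: nNA | exact: nNH].
  - by apply: normaliserM; [exact: nNH | exact: nNA].
  - exact/nNH/HV.
have AJ h a : H h -> A a -> A (h * a * h^-1).
  by move=> /HD/nA Nh; exact: normaliserJ.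
have conjK h c : H h -> coset_conj N h (coset_conj N h^-1 c) = c.
  move=> Hh; rewrite /coset_conj coset_inv; last exact: nNH.
  by rewrite invgK !mulgA mulgV mul1g mulgK.
split.
  split.
  - move=> h Hh; split; last first.
      by move=> x y _ _; rewrite /coset_conj !mulgA mulgVK.
    split.
    + by move=> _ [a Aa <-]; rewrite conj_coset //; exists (h * a * h^-1) => //;
        apply: (AJ).
    + by move=> x y _ _ /mulIg/mulgI.
    + move=> _ [a Aa <-] /=; exists (coset_conj N h^-1 (coset N a)).
        rewrite conj_coset; [| exact: HV | by []].
        by exists (h^-1 * a * h^-1^-1) => //; apply: (AJ) => //; apply: HV.
      exact: conjK.
  - by move=> c _; rewrite /coset_conj coset_id1 mul1g invg1 mulg1.
  - move=> p q c Hp Hq _; rewrite /coset_conj coset_morph ?invgM ?mulgA //.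
      exact: nNH.
    exact: nNH.
exists (fun u => u.1 * coset N u.2); split; last first.
  move=> n q n' q' _ Hq _ Hq'; rewrite /coset_conj /=.
  rewrite coset_morph ?mulgA ?mulgVK //; exact: nNH.
split.
- move=> [_ h] [[a Aa <-] /= Hh]; exists (a * h).
    by rewrite -DE; exists a => //; exists h.
  by rewrite coset_morph //; [exact: nNA | exact: nNH].
- move=> [_ h] [_ h'] /set_mem[/= [a Aa <-] Hh] /set_mem[/= [b Ab <-] Hh'] e.
  have : h = h'.
    move: (e); rewrite -!coset_morph; try by [exact: nNA | exact: nNH].
    rewrite coset_eq; try by apply: normaliserM; [exact: nNA | exact: nNH].
    move=> /NA Ax.
    have Ahh : A (h^-1 * h').
      (* Both factors lie in A: the first is a conjugate of b^-1 a by an element of H, the second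
         lies in N because the two cosets agree. *)
      have -> : h^-1 * h' = (h^-1 * (b^-1 * a) * h^-1^-1) * ((a * h)^-1 * (b * h')).
        by rewrite invgK invgM !mulgA mulgK (mulgK a) mulgVK.
      by apply: (AM) => //; apply: (AJ); [exact: HV | apply: (AM) => //; apply: AV].
    have : (A `&` H) (h^-1 * h') by split=> //; apply: HM => //; apply: HV.
    by rewrite AH1 /= => e1; rewrite -(mulVKg h h') e1 mulg1.
  by move=> hh'; move: e; rewrite hh' => /mulIg ->.
- move=> _ [x + <-]; rewrite -{1}DE => -[a Aa [h Hh <-]].
  exists (coset N a, h) => /=; first by split=> //; exists a.
  by rewrite -coset_morph //; [exact: nNA | exact: nNH].
Qed.

Lemma isog_sdprod_trans G1 G2 G3 H (D : set G2) (D' : set G3) (N : set G1)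
    (Q : set H) (act : H -> G1 -> G1) :
  is_subgroup N -> is_subgroup Q ->
  isog_sdprod D N Q act -> isog D D' -> isog_sdprod D' N Q act.
Proof.
move=> [_ NM _] [_ QM _] [acts [f [fb fM]]] [g [gb gM]]; split=> //.
exists (g \o f); split; first exact: set_bij_comp gb.
move=> n q n' q' Nn Qq Nn' Qq' /=.
have fD u : (N `*` Q) u -> D (f u) by case: fb => + _ _; apply.
by rewrite fM // gM //; apply: fD; split.
Qed.

End GroupTheory.

(** * Algebra automorphisms and conjugations by units *)

Section AlgAutTheory.
Local Open Scope ring_scope.
Variables (T : comNzRingType) (A : algType T).
Implicit Types f g : algaut A.

Lemma algautD f : {morph f : x y / x + y}.
Proof.
by have [_ lf _] := algautP f => x y; have := lf 1 x y; rewrite !scale1r.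
Qed.

Lemma algaut_mul f : {morph f : x y / x * y}.
Proof. by have [_ _ []] := algautP f. Qed.

Lemma algaut_one f : f 1 = 1.
Proof. by have [_ _ []] := algautP f. Qed.

Lemma algaut_zero f : f 0 = 0.
Proof. by apply: (addrI (f 0)); rewrite -algautD !addr0. Qed.

Lemma algautB f : {morph f : x y / x - y}.
Proof.
by move=> x y; apply: (addIr (f y)); rewrite -algautD !subrK.
Qed.

Lemma algautZ f t x : f (t *: x) = t *: f x.
Proof.
by have [_ lf _] := algautP f; have := lf t x 0; rewrite !addr0 algaut_zero addr0.
Qed.

Lemma algautMg f g x : (f * g)%g x = f (g x).
Proof. by []. Qed.

Lemma algautKg f x : (f^-1)%g (f x) = x.
Proof. exact: algautK. Qed.

Lemma algautVKg f x : f ((f^-1)%g x) = x.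
Proof. exact: algautKV. Qed.

Lemma algaut_eq f g : f =1 g -> f = g.
Proof. by move=> fg; apply/val_inj/funext. Qed.

Lemma invertible_algaut f v : invertible v -> invertible (f v).
Proof.
by move=> [w [vw wv]]; exists (f w); rewrite -!algaut_mul vw wv algaut_one.
Qed.

Lemma is_algaut_conj (v w : A) :
  v * w = 1 -> w * v = 1 -> is_algaut (fun a => w * a * v).
Proof.
move=> vw wv; apply/asboolP; split.
- exists (fun a => v * a * w) => a; rewrite !mulrA.
    by rewrite vw mul1r -mulrA vw mulr1.
  by rewrite wv mul1r -mulrA wv mulr1.
- by move=> t a b; rewrite mulrDr mulrDl -scalerAr -scalerAl.
- split=> [|a b] /=; first by rewrite mulr1.
  by rewrite !mulrA -(mulrA (w * a) v w) vw mulr1.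
Qed.

Lemma inner_by_ex (v : A) : invertible v -> exists f, inner_by v f.
Proof.
by move=> [w [vw wv]]; exists (AlgAut (is_algaut_conj vw wv)); exists w.
Qed.

(** Source of the normality of all groups of inner automorphisms below: only the kind of unit that
    [f v] is remains to be checked. *)
Lemma inner_by_conj v f g : inner_by v g -> inner_by (f v) (f * g * f^-1)%g.
Proof.
move=> [w [vw wv gE]]; exists (f w); rewrite -!algaut_mul vw wv algaut_one.
split=> // a; rewrite algautMg algautMg gE !algaut_mul.
by rewrite algautVKg.
Qed.

Lemma inner_by_inj v f g : inner_by v f -> inner_by v g -> f = g.
Proof.
move=> [w [vw wv fE]] [w' [vw' w'v gE]]; apply: algaut_eq => a.
by rewrite fE gE; congr (_ * _ * _); rewrite -[w]mulr1 -vw' mulrA wv mul1r.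
Qed.

Lemma inner_normal f : normaliser (inner A) f.
Proof.
apply: normaliser_conj => g x [v vx]; exists (g v); exact: inner_by_conj.
Qed.

Lemma inner_byE v f a : inner_by v f -> v * f a = a * v.
Proof. by move=> [w [vw wv ->]]; rewrite !mulrA vw mul1r. Qed.

End AlgAutTheory.

(** * The projection onto L, the idempotents e_c and unipotent elements *)

Section IncidenceTheory.
Local Open Scope ring_scope.
Variables (d : Order.disp_t) (X : locFinPreorderType d).
Variables (T : comNzRingType) (R : algType T).
Notation K := (incidence X R).
Notation L := (blockdiag X R).
Notation eK c := (bd_inc (idem R c)).
Implicit Types (f g b v : K) (a : L) (c : Xbar X) (phi psi : algaut K).

Lemma sim_refl (x : X) : sim x x.
Proof. by rewrite /sim lexx. Qed.

Lemma cls_repr c : cls (repr c) = c.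
Proof. exact: reprK. Qed.

Lemma incM f g x y : (f * g) x y = \sum_(z <- itv x y) f x z * g z y.
Proof. by []. Qed.

Lemma blockdiag_eq0 a x y : ~~ sim x y -> a x y = 0.
Proof. by case: a => a /= /asboolP; apply. Qed.

Lemma blockdiagP (a1 a2 : L) : (a1 : K) = a2 -> a1 = a2.
Proof. exact: val_inj. Qed.

Lemma blockdiagM (a1 a2 : L) : bd_inc (a1 * a2) = (a1 : K) * a2.
Proof. by []. Qed.

Lemma projLK a : projL a = a.
Proof.
apply/blockdiagP/incP => x y /=; case: ifP => // /negbT sxy.
by rewrite blockdiag_eq0.
Qed.

Lemma ideal_MP b : ideal_M b <-> projL b = 0.
Proof.
split=> [b0|b0 x y sxy].
  by apply/blockdiagP/incP => x y /=; case: ifP => // /b0.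
by have := congr1 (fun a : L => a x y) b0; rewrite /= sxy.
Qed.

Lemma projLD : {morph (@projL _ X _ R) : f g / f + g}.
Proof.
move=> f g; apply/blockdiagP/incP => x y /=.
by case: ifP; rewrite ?addr0.
Qed.

Lemma projLB : {morph (@projL _ X _ R) : f g / f - g}.
Proof.
move=> f g; apply/blockdiagP/incP => x y /=.
by case: ifP; rewrite ?subr0.
Qed.

Lemma projL0 : projL (0 : K) = 0.
Proof. exact: (projLK 0). Qed.

Lemma projL1 : projL (1 : K) = 1.
Proof. exact: (projLK 1). Qed.

Lemma projLZ (t : T) f : projL (t *: f) = t *: projL f.
Proof.
apply/blockdiagP/incP => x y /=.
by case: ifP; rewrite ?scaler0.
Qed.

(** If x ~ y, the whole interval [x,y] lies in one class and no term is lost; otherwise no z is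
    equivalent to both ends. Thus [projL] is the quotient map K -> K/M = L. *)
Lemma projLM : {morph (@projL _ X _ R) : f g / f * g}.
Proof.
move=> f g; apply/blockdiagP/incP => x y /=; case: ifP => sxy.
  apply: eq_big_seq => z; rewrite Defs.in_itv => /andP[xz zy].
  have /andP[xy yx] := sxy.
  by rewrite /sim xz zy (le_trans zy yx) (le_trans yx xz).
rewrite big1 // => z _; case: ifP => [/andP[xz zx]|]; last by rewrite mul0r.
case: ifP; last by rewrite mulr0.
move=> /andP[zy yz]; move: sxy.
by rewrite /sim (le_trans xz zy) (le_trans yz zx).
Qed.

Lemma mulr_idem f c x y : (f * eK c) x y = if cls y == c then f x y else 0.
Proof.
rewrite incM; case: (boolP (x <= y)%O) => [xy|nxy]; last first.
  rewrite inc0 // if_same big_seq big1 // => z.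
  by rewrite Defs.in_itv => /andP[xz zy]; rewrite (le_trans xz zy) in nxy.
rewrite (big_fsetD1 y) ?itv_r //= eqxx /= big_seq big1 => [|z]; last first.
  by rewrite in_fsetD1 => /andP[/negPf -> _]; rewrite mulr0.
by case: eqP => _; rewrite addr0 ?mulr1 ?mulr0.
Qed.

Lemma mul_idemr f c x y : (eK c * f) x y = if cls x == c then f x y else 0.
Proof.
rewrite incM; case: (boolP (x <= y)%O) => [xy|nxy]; last first.
  rewrite inc0 // if_same big_seq big1 // => z.
  by rewrite Defs.in_itv => /andP[xz zy]; rewrite (le_trans xz zy) in nxy.
rewrite (big_fsetD1 x) ?itv_l //= eqxx /= big_seq big1 => [|z]; last first.
  by rewrite in_fsetD1 eq_sym => /andP[/negPf -> _]; rewrite mul0r.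
by case: eqP => _; rewrite addr0 ?mul1r ?mul0r.
Qed.

(** Replaces the decomposition of 1 into the e_c, which is not a finite sum when there are
    infinitely many classes. *)
Lemma idem_ext f g : (forall c, f * eK c = g * eK c) -> f = g.
Proof.
move=> fg; apply: incP => x y.
have : (f * eK (cls y)) x y = (g * eK (cls y)) x y by rewrite fg.
by rewrite !mulr_idem eqxx.
Qed.

Lemma idem_comm a c : idem R c * a = a * idem R c.
Proof.
apply/blockdiagP/incP => x y; rewrite -[LHS]/((eK c * a) x y) mul_idemr.
rewrite -[RHS]/(((a : K) * eK c) x y) mulr_idem.
case: (boolP (sim x y)) => [|/(blockdiag_eq0 a) ->]; last by rewrite !if_same.
by rewrite -clsP => /eqP ->.
Qed.

Lemma idem_commK a c : eK c * a = (a : K) * eK c.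
Proof. exact: (congr1 (@bd_inc _ _ _ _) (idem_comm a c)). Qed.

Lemma idemM c c' : idem R c * idem R c' = if c == c' then idem R c else 0.
Proof.
apply/blockdiagP/incP => x y; rewrite -[LHS]/((eK c * eK c') x y).
rewrite mul_idemr /=; case: (eqVneq c c') => [->|ncc'] /=.
  by case: (cls x == c'); rewrite ?andbF.
case: eqP => //= ->; rewrite (negPf ncc') andbF //.
Qed.

Lemma idemMK c c' :
  eK c * eK c' = if c == c' then eK c else 0.
Proof.
have := congr1 (@bd_inc _ _ _ _) (idemM c c'); rewrite /= => ->.
by case: ifP.
Qed.

Lemma idem_inj c c' : idem R c = idem R c' -> c = c'.
Proof.
move=> /(congr1 (fun a : L => a (repr c) (repr c))).
rewrite /= eqxx cls_repr eqxx /=.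
by case: eqP => //= _ /eqP; rewrite oner_eq0.
Qed.

Lemma idem_neq0 c : idem R c <> 0.
Proof.
move=> /(congr1 (fun a : L => a (repr c) (repr c))).
rewrite /= eqxx cls_repr eqxx /=.
by move/eqP; rewrite oner_eq0.
Qed.

Lemma projL_corner f c : eK c * projL f * eK c = eK c * f * eK c.
Proof.
apply: incP => x y; rewrite !mulr_idem !mul_idemr /=.
case: eqP => // yc; case: eqP => // xc; case: ifP => // /negP[].
by rewrite -clsP xc yc.
Qed.

Lemma corner_ideal_M b c : projL b = 0 -> eK c * b * eK c = 0.
Proof. by move=> b0; rewrite -projL_corner b0 mulr0 mul0r. Qed.

Lemma blockdiag_corner0 a : (forall c, idem R c * a * idem R c = 0) -> a = 0.
Proof.
move=> a0; apply/blockdiagP/idem_ext => c.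
have := congr1 (@bd_inc _ _ _ _) (a0 c).
by rewrite idem_comm -mulrA idemM eqxx /= mul0r.
Qed.

(** For x <= y the matrix unit at (x,y) is a nonzero element of the corner. So the order of the
    classes is encoded in the multiplication, and automorphisms permuting the e_c transport it. *)
Lemma le_corner c c' :
  (c <= c')%O = ~~ `[< forall f, eK c * f * eK c' = 0 >].
Proof.
rewrite -(cls_repr c) -(cls_repr c').
set x := repr c; set y := repr c'.
rewrite -[LHS]/(le_bar _ _) le_barE; apply/idP/negP => [xy|].
  have Ep : is_incidence (fun s t : X => ((s == x) && (t == y))%:R : R).
    apply/asboolP => s t st; case: eqP => //= sx; case: eqP => //= ty.
    by move: st; rewrite sx ty xy.
  move=> /asboolP /(_ (Incidence Ep)) /(congr1 (fun g : K => g x y)).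
  by rewrite mulr_idem mul_idemr !eqxx /= !eqxx => /eqP; rewrite oner_eq0.
case: (boolP (x <= y)%O) => // nxy []; apply/asboolP => f.
apply: incP => s t; rewrite mulr_idem mul_idemr.
case: eqP => // /eqP; rewrite clsP => /andP[ty yt].
case: eqP => // /eqP; rewrite clsP => /andP[sx xs].
apply: inc0; apply: contra nxy => st.
exact: le_trans xs (le_trans st ty).
Qed.

(** Entries of b inside a class vanish, so a nonzero factor [b x z] has z strictly above x; then
    [z,y] lacks x and is smaller than [x,y]. *)
Lemma expr_ideal_M b k x y : projL b = 0 ->
  (#|` itv x y| <= k)%N -> (b ^+ k) x y = 0.
Proof.
move=> /ideal_MP b0; elim: k x y => [|k IHk] x y.
  rewrite leqn0 cardfs_eq0 => /eqP i0; apply: inc0.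
  by apply/negP => /itv_l; rewrite i0 inE.
move=> lek; rewrite exprS incM big_seq big1 // => z.
rewrite Defs.in_itv => /andP[xz zy].
have [zx|nzx] := boolP (z <= x)%O; first by rewrite b0 ?mul0r // /sim xz zx.
rewrite IHk ?mulr0 // -ltnS; apply: leq_trans lek.
apply: fproper_ltn_card; rewrite fproperE; apply/andP; split.
  apply/fsubsetP => t.
  by rewrite !Defs.in_itv => /andP[zt ->]; rewrite (le_trans xz zt).
apply/fsubsetPn; exists x; first by rewrite Defs.in_itv lexx (le_trans xz zy).
by rewrite Defs.in_itv (negPf nzx).
Qed.

(* The geometric series of [b] is a finite sum at each pair of points. *)
Lemma unipotent_linv b : projL b = 0 ->
  exists w, [/\ w * (1 - b) = 1, (1 - b) * w = 1 & projL w = 1].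
Proof.
move=> b0; pose S n := \sum_(k < n) b ^+ k.
have Sstab n x y : (#|` itv x y| <= n)%N -> S n x y = S #|` itv x y| x y.
  move=> /subnKC <-; rewrite /S; elim: (_ - _)%N => [|m IHm].
    by rewrite addn0.
  rewrite addnS big_ord_recr -[LHS]/((S _ x y) + (b ^+ _) x y) IHm.
  by rewrite (expr_ideal_M b0) ?addr0 // leq_addr.
have wP : is_incidence (fun x y => S #|` itv x y| x y).
  by apply/asboolP => x y; exact: inc0.
pose w := Incidence wP.
have wE n x y : (#|` itv x y| <= n)%N -> w x y = S n x y by move/Sstab => ->.
have itvS x y z t : x \in itv z t -> y \in itv z t ->
    (#|` itv x y| <= #|` itv z t|)%N.
  rewrite !Defs.in_itv => /andP[zx xt] /andP[zy yt]; apply: fsubset_leq_card.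
  apply/fsubsetP => s; rewrite !Defs.in_itv => /andP[xs sy].
  by rewrite (le_trans zx xs) (le_trans sy yt).
have memx x y z : z \in itv x y -> x \in itv x y.
  by rewrite Defs.in_itv => /andP[xz zy]; apply/itv_l/(le_trans xz zy).
have memy x y z : z \in itv x y -> y \in itv x y.
  by rewrite Defs.in_itv => /andP[xz zy]; apply/itv_r/(le_trans xz zy).
exists w; split.
(* For z in [x,y] the interval [x,z] is no larger than [x,y], so one partial sum [S n] replaces w in
   the whole product, which telescopes to 1 - b^n. *)
- apply: incP => x y; set n := #|` itv x y|.
  transitivity ((S n * (1 - b)) x y).
    rewrite !incM; apply: eq_big_seq => z zi; rewrite (@wE n) //.
    by apply: itvS => //; exact: memx zi.
  have -> : S n * (1 - b) = 1 - b ^+ n.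
    by rewrite /S; elim: (n) => [|m IHm]; rewrite ?big_ord0 ?mul0r ?expr0 ?subrr //;
      rewrite big_ord_recr /= mulrDl IHm mulrBr mulr1 -exprSr addrA subrK.
  by rewrite -[LHS]/((1 : K) x y - (b ^+ n) x y) (expr_ideal_M b0) ?subr0.
- apply: incP => x y; set n := #|` itv x y|.
  transitivity (((1 - b) * S n) x y).
    rewrite !incM; apply: eq_big_seq => z zi; rewrite (@wE n) //.
    by apply: itvS => //; exact: memy zi.
  have -> : (1 - b) * S n = 1 - b ^+ n by rewrite -opprB mulNr -subrX1 opprB.
  by rewrite -[LHS]/((1 : K) x y - (b ^+ n) x y) (expr_ideal_M b0) ?subr0.
- apply/blockdiagP/incP => x y /=; case: ifP => sxy; last first.
    by case: eqP => // exy; rewrite exy sim_refl in sxy.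
  (* One more term than the stable sum is taken: once b^0 = 1 is split off, the rest is b times the
     stable sum, an element of M. *)
  rewrite -(@Sstab #|` itv x y|.+1) ?leqnSn // /S big_ord_recl expr0.
  transitivity ((1 : K) x y + (b * S #|`itv x y|) x y); last first.
    have := congr1 (fun a : L => a x y) (projLM b (S #|`itv x y|)).
    by rewrite b0 mul0r /= sxy => ->; rewrite addr0.
  rewrite -[LHS]/((1 : K) x y + (\sum_(i < _) _ : K) x y) /S mulr_sumr.
  by congr (_ + (_ : K) x y); apply: eq_bigr => i _; rewrite exprS.
Qed.

Lemma unipotent_inv v : projL v = 1 ->
  exists w, [/\ v * w = 1, w * v = 1 & projL w = 1].
Proof.
move=> v1; have [|w [wv vw w1]] := @unipotent_linv (1 - v).
  by rewrite projLB v1 projL1 subrr.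
by move: wv vw; rewrite subKr => wv vw; exists w.
Qed.

End IncidenceTheory.

(** * Automorphisms of K under Condition (II): the action on K/M and the reduction to diagonal
    ones *)

Section ConditionII.
Local Open Scope ring_scope.
Variables (d : Order.disp_t) (X : locFinPreorderType d).
Variables (T : comNzRingType) (R : algType T).
Notation K := (incidence X R).
Notation L := (blockdiag X R).
Notation eK c := (bd_inc (idem R c)).
Implicit Types (f b v : K) (a : L) (c : Xbar X) (phi psi : algaut K).

Hypothesis cII : condition_II X R.

Lemma algaut_idem phi c : exists c', projL (phi (eK c)) = idem R c'.
Proof.
have [y /ideal_MP] := cII phi (repr c); rewrite cls_repr projLB projLK => e.
by exists (cls y); apply/eqP; rewrite -subr_eq0 e.
Qed.

(** The invariance of M is not yet available. Write phi^-1(e_c') = e_c + m with m in M, and let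
    phi(e_c) be e_c'' modulo M. Applying phi to e_c m e_c = 0 gives e_c''(e_c' - e_c'')e_c'' = 0
    modulo M, which forces c'' = c'. *)
Lemma algaut_idem_onto phi c' : exists c, projL (phi (eK c)) = idem R c'.
Proof.
have [c ec] := algaut_idem (phi^-1)%g c'.
have [c'' ec''] := algaut_idem phi c; exists c.
pose m : K := (phi^-1)%g (eK c') - eK c.
have m0 : projL m = 0 by rewrite projLB ec projLK subrr.
have phim : projL (phi m) = idem R c' - idem R c''.
  by rewrite algautB algautVKg projLB projLK ec''.
have : projL (phi (eK c * m * eK c)) = 0.
  by rewrite corner_ideal_M // algaut_zero projL0.
rewrite !algaut_mul !projLM ec'' phim mulrBr !idemM eqxx.
case: (eqVneq c'' c') => [<- //|_].
rewrite sub0r mulNr idemM eqxx => /eqP.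
by rewrite oppr_eq0 => /eqP /idem_neq0.
Qed.

(** Every e_c' is, modulo M, the image of some e_c, so each diagonal corner of phi(b) comes from a
    corner e_c b e_c = 0. *)
Lemma algaut_ideal_M phi b : projL b = 0 -> projL (phi b) = 0.
Proof.
move=> b0; apply: blockdiag_corner0 => c'.
have [c <-] := algaut_idem_onto phi c'.
by rewrite -!projLM -!algaut_mul corner_ideal_M // algaut_zero projL0.
Qed.

(** As M is preserved, [alpha phi] is the map induced on K/M = L; this is what makes [alpha]
    compatible with composition. *)
Lemma projL_algaut phi f : projL (phi f) = alpha phi (projL f).
Proof.
rewrite -[f in LHS](subrK (projL f : K)) algautD projLD algaut_ideal_M ?add0r //.
by rewrite projLB projLK subrr.
Qed.

Lemma alpha_comp phi psi a : alpha (phi * psi)%g a = alpha phi (alpha psi a).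
Proof. by rewrite {1}/alpha algautMg projL_algaut. Qed.

Lemma alpha_id a : alpha (1%g : algaut K) a = a.
Proof. exact: projLK. Qed.

Lemma alpha_algaut phi : is_algaut (alpha phi).
Proof.
apply/asboolP; split.
- exists (alpha (phi^-1)%g) => a; rewrite -alpha_comp ?mulVg ?mulgV alpha_id //.
- move=> t a1 a2; rewrite /alpha -projLZ -projLD; congr projL.
  by rewrite -algautZ -algautD.
- split=> [|a1 a2]; rewrite /alpha.
    by rewrite (_ : bd_inc 1 = 1 :> K) // algaut_one projL1.
  by rewrite -projLM -algaut_mul.
Qed.

(** Bundling through [insubd] gives a total function into the group Aut L; under Condition (II) its
    underlying map is [alpha phi]. *)
Definition alpha_aut phi : algaut L := insubd (1%g : algaut L) (alpha phi).

Lemma alpha_autE phi : alpha_aut phi = alpha phi :> (L -> L).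
Proof. by rewrite /alpha_aut -[LHS]/(val _) insubdK //; exact: alpha_algaut. Qed.

Lemma alpha_autM phi psi :
  alpha_aut (phi * psi)%g = (alpha_aut phi * alpha_aut psi)%g.
Proof.
by apply: algaut_eq => a; rewrite algautMg !alpha_autE alpha_comp.
Qed.

Lemma alpha_aut_morph (S : set (algaut K)) : morph_on S alpha_aut.
Proof. by move=> phi psi _ _; exact: alpha_autM. Qed.

Lemma alpha_aut1 : alpha_aut 1%g = 1%g.
Proof. by apply: algaut_eq => a; rewrite alpha_autE alpha_id. Qed.

Lemma alpha_autV phi : alpha_aut (phi^-1)%g = ((alpha_aut phi)^-1)%g.
Proof. exact: (morph_onV (is_subgroupT _) (@alpha_aut_morph setT)). Qed.

Lemma diag_imageE (S : set (algaut K)) : diag_image S = alpha_aut @` S.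
Proof.
apply/seteqP; split=> a [phi Sphi].
  by move=> e; exists phi => //; apply: val_inj; rewrite /= e alpha_autE.
by move=> <-; exists phi => //; rewrite alpha_autE.
Qed.

Lemma alpha_inner v phi : inner_by v phi -> inner_by (projL v) (alpha_aut phi).
Proof.
move=> [w [vw wv phiE]]; exists (projL w); rewrite -!projLM vw wv projL1.
by split=> // a; rewrite alpha_autE /alpha phiE !projLM projLK.
Qed.

Lemma inner_by_lift (u : L) phi (al : algaut L) :
  inner_by (u : K) phi -> inner_by u al -> alpha_aut phi = al.
Proof. by move=> /alpha_inner; rewrite projLK; exact: inner_by_inj. Qed.

Lemma LambdaP phi : Lambda X R phi <-> forall a, phi a = alpha phi a.
Proof.
split=> [e a|e].
  apply/eqP; rewrite -subr_eq0; apply/eqP.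
  exact: (congr1 (fun h : L -> K => h a) e).
by apply/funext => a; rewrite /delta /projM e projLK subrr.
Qed.

Lemma Lambda_intro phi :
  (forall a, exists a', phi a = a' :> K) -> Lambda X R phi.
Proof.
move=> h; apply/LambdaP => a; rewrite /alpha.
by have [a' ->] := h a; rewrite projLK.
Qed.

Lemma Lambda_subgroup : is_subgroup (Lambda X R).
Proof.
split.
- by apply: Lambda_intro => a; exists a.
- move=> phi psi /LambdaP h1 /LambdaP h2; apply: Lambda_intro => a.
  by exists (alpha phi (alpha psi a)); rewrite algautMg h2 h1.
- move=> phi /LambdaP h; apply: Lambda_intro => a; exists (alpha (phi^-1)%g a).
  have {1}-> : a = alpha phi (alpha (phi^-1)%g a).
    by rewrite -alpha_comp mulgV alpha_id.
  by rewrite -h algautKg.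
Qed.

Definition fix_idem (al : algaut L) :=
  forall c, al (idem R c) = idem R c.

(** The idempotent e is the identity of its corner. If al maps eLe onto itself, then al(e) e = al(e)
    since al(e) is in eLe, and al(e) e = e since e is the image of an element of eLe. *)
Lemma preserves_RxP (al : algaut L) :
  preserves_Rx al <-> fix_idem al.
Proof.
have ee c : idem R c * idem R c = idem R c by rewrite idemM eqxx.
split=> [h c|h x].
  have := h (repr c); rewrite /Rx cls_repr; move: (ee c).
  move: (idem R c) => e {}ee hc.
  have [r re] : exists r, al e = e * r * e.
    have : (corner e) (al e).
      by rewrite -hc; exists e => //; exists 1 => //; rewrite mulr1 ee.
    by move=> [r _ <-]; exists r.
  have [s se] : exists s, al (e * s * e) = e.
    have : (al @` corner e) e by rewrite hc; exists 1 => //; rewrite mulr1 ee.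
    by move=> [_ [s _ <-] s2]; exists s.
  have : al e * e = al e by rewrite re -!mulrA ee.
  by rewrite -{2}se -algaut_mul !mulrA ee se.
apply/seteqP; split=> z.
  move=> [_ [r _ <-] <-]; exists (al r) => //.
  by rewrite !algaut_mul h.
move=> [r _ <-]; exists (idem R (cls x) * (al^-1)%g r * idem R (cls x)).
  by exists ((al^-1)%g r).
by rewrite !algaut_mul h algautVKg.
Qed.

Lemma CP phi : C X R phi <-> Lambda X R phi /\ fix_idem (alpha_aut phi).
Proof. by rewrite /C /= -alpha_autE preserves_RxP. Qed.

Lemma In1P phi : In1 X R phi <-> exists2 v, projL v = 1 & inner_by v phi.
Proof.
split=> [[b /ideal_MP b0 h]|[v v1 h]].
  by exists (1 + b) => //; rewrite projLD b0 projL1 addr0.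
exists (v - 1); last by rewrite addrC subrK.
by apply/ideal_MP; rewrite projLB v1 projL1 subrr.
Qed.

Lemma In1_subgroup : is_subgroup (In1 X R).
Proof.
split.
- by apply/In1P; exists 1; [exact: projL1 | exact: inner_by1].
- move=> phi psi /In1P[v v1 iv] /In1P[w w1 iw]; apply/In1P; exists (w * v).
    by rewrite projLM v1 w1 mulr1.
  exact: inner_byM.
- move=> phi /In1P[v v1 iv]; apply/In1P; have [w [vw wv w1]] := unipotent_inv v1.
  by exists w => //; exact: inner_byV iv.
Qed.

Lemma In1_normal phi : normaliser (In1 X R) phi.
Proof.
apply: normaliser_conj => g x /In1P[v v1 iv]; apply/In1P; exists (g v).
  by rewrite projL_algaut v1 -alpha_autE algaut_one.
exact: inner_by_conj.
Qed.

Lemma In1_inner phi : In1 X R phi -> inner K phi.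
Proof. by move=> /In1P[v _ iv]; exists v. Qed.

Lemma alpha_In1 phi : In1 X R phi -> alpha_aut phi = 1%g.
Proof.
move=> /In1P[v v1 /alpha_inner]; rewrite v1 => h.
exact: inner_by_inj h (inner_by1 _).
Qed.

(** Here alpha is trivial, so phi fixes every e_c and v commutes with it; hence v is block diagonal
    and equals its projection 1. *)
Lemma In1_Lambda phi : In1 X R phi -> Lambda X R phi -> phi = 1%g.
Proof.
move=> h /LambdaP hL; have /In1P[v v1 iv] := h.
suff -> : phi = 1%g by [].
apply: (@inner_by_inj _ _ v) => //; suff -> : v = 1 by exact: inner_by1.
have va c : eK c * v = v * eK c.
  by rewrite -(inner_byE _ iv) hL -alpha_autE alpha_In1.
apply: idem_ext => c; rewrite mul1r -va.
have -> : eK c * v = eK c * v * eK c by rewrite -mulrA -va mulrA idemMK eqxx.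
by rewrite -projL_corner v1 mulr1 idemMK eqxx.
Qed.

(* With g = phi o alpha^-1 : L -> K, column y of v is that of g(e_[y]); then  *)
(* v^-1 g v fixes every e_c, hence all of L.                                  *)
Lemma In1_Lambda_decomp phi :
  exists2 psi, In1 X R psi & Lambda X R (psi * phi)%g.
Proof.
pose g (a : L) : K := phi ((alpha_aut phi)^-1%g a : L).
have gM a1 a2 : g (a1 * a2) = g a1 * g a2.
  by rewrite /g (algaut_mul (alpha_aut phi)^-1%g) blockdiagM algaut_mul.
have gL a : projL (g a) = a.
  by rewrite /g projL_algaut projLK -alpha_autE algautVKg.
have g0 : g 0 = 0 by rewrite /g !algaut_zero.
have vP : is_incidence (fun x y => g (idem R (cls y)) x y).
  by apply/asboolP => x y; exact: inc0.
pose v := Incidence vP.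
(* Column y of the left side is that of g(e_c) g(e_[y]) = g(e_c e_[y]), which is g(e_c) if y lies in
   c and 0 otherwise. *)
have gv c : g (idem R c) * v = v * eK c.
  apply: incP => x y; transitivity ((g (idem R c) * g (idem R (cls y))) x y).
    by [].
  rewrite mulr_idem -gM idemM eq_sym; case: eqP => [<- //|_].
  by rewrite g0.
have v1 : projL v = 1.
  apply/blockdiagP/incP => x y; rewrite /=; case: ifP => sxy; last first.
    by case: eqP => // exy; rewrite exy sim_refl in sxy.
  have := congr1 (fun a : L => a x y) (gL (idem R (cls y))).
  rewrite /= sxy => ->; move: sxy; rewrite -clsP => /eqP ->.
  by rewrite eqxx andbT.
have [w [vw wv w1]] := unipotent_inv v1.
(* The map a -> w g(a) v is multiplicative and fixes e_c, so it sends e_c a e_c into the corner at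
   c, where only the projection to L counts; that projection is a. *)
have hE a : w * g a * v = a.
  apply: idem_ext => c.
  have he : w * g (idem R c) * v = eK c by rewrite -mulrA gv mulrA wv mul1r.
  have hM a1 a2 : w * g (a1 * a2) * v = (w * g a1 * v) * (w * g a2 * v).
    by rewrite gM !mulrA -(mulrA (w * g a1) v w) vw mulr1.
  transitivity (w * g (idem R c * a * idem R c) * v).
    have -> : idem R c * a * idem R c = a * idem R c.
      by rewrite idem_comm -mulrA idemM eqxx.
    by rewrite hM he.
  rewrite !hM he -projL_corner !projLM w1 v1 gL mul1r mulr1.
  by rewrite idem_commK -mulrA idemMK eqxx.
have [psi psiv] : exists psi : algaut K, inner_by v psi.
  by apply: inner_by_ex; exists w.
exists psi; first by apply/In1P; exists v.
apply: Lambda_intro => a; exists (alpha phi a); rewrite algautMg.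
have [w' [vw' w'v ->]] := psiv.
have -> : w' = w by rewrite -[w']mulr1 -vw mulrA w'v mul1r.
by have := hE (alpha phi a); rewrite /g -alpha_autE algautKg.
Qed.

(** Composing with an element of In_1 leaves alpha unchanged and makes the automorphism diagonal.
    Then e_c goes to e_{q(c)} exactly, not only modulo M, so nonzero corners e_c K e_c' are matched
    and [le_corner] applies. *)
Lemma alpha_perm phi :
  exists q : ordaut (Xbar X), forall c, alpha phi (idem R c) = idem R (q c).
Proof.
have [psi psi1 lam] := In1_Lambda_decomp phi.
have aE : alpha_aut (psi * phi)%g = alpha_aut phi.
  by rewrite alpha_autM alpha_In1 // mul1g.
rewrite -alpha_autE -aE; set al := alpha_aut _.
move: lam; rewrite /al; move: (psi * phi)%g => lam {al aE psi psi1} Llam.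
have /choice[q qE] c : exists c', alpha_aut lam (idem R c) = idem R c'.
  rewrite alpha_autE; have [c' e] := algaut_idem lam c.
  by exists c'; rewrite /alpha e.
have /choice[q' q'E] c : exists c', (alpha_aut lam)^-1%g (idem R c) = idem R c'.
  rewrite -alpha_autV alpha_autE; have [c' e] := algaut_idem (lam^-1)%g c.
  by exists c'; rewrite /alpha e.
suff qP : is_ordaut q by exists (OrdAut qP).
have lamE c : lam (eK c) = eK (q c).
  by have /LambdaP -> := Llam; rewrite -alpha_autE qE.
apply/asboolP; split.
  exists q' => c; apply: (@idem_inj _ _ _ R).
    by rewrite -q'E -qE algautKg.
  by rewrite -qE -q'E algautVKg.
move=> c c'; rewrite !(le_corner R); congr (~~ _); apply/asboolP/asboolP => h f.
  have := h (lam f); rewrite -!lamE -!algaut_mul => e.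
  by rewrite -[LHS](algautKg lam) e algaut_zero.
by rewrite -[f](algautVKg lam) -!lamE -!algaut_mul h algaut_zero.
Qed.

Lemma inner0_Lambda phi : inner0 phi -> Lambda X R phi.
Proof.
move=> [u [u' [uu' u'u]] [w [uw wu phiE]]]; apply: Lambda_intro => a.
exists (u' * a * u); rewrite phiE; congr (_ * _ * _).
have uu'K : (u : K) * u' = 1 by exact: (congr1 (@bd_inc _ _ _ _) uu').
by rewrite -[w]mulr1 -uu'K mulrA wu mul1r.
Qed.

Lemma inner0_C phi : inner0 phi -> C X R phi.
Proof.
move=> i0; apply/CP; split; first exact: inner0_Lambda.
move=> c; have [u _ /alpha_inner] := i0; rewrite projLK => -[w [_ wu ->]].
by rewrite -mulrA idem_comm mulrA wu mul1r.
Qed.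

Lemma inner0_inner phi : inner0 phi -> inner K phi.
Proof. by move=> [u _ iu]; exists (u : K). Qed.

(** Let u be the projection of v to L. Dividing phi by the conjugation by u leaves the conjugation
    by u^-1 v, which is both diagonal and in In_1, hence trivial. *)
Lemma inner_Lambda phi : inner K phi -> Lambda X R phi -> inner0 phi.
Proof.
move=> [v iv] Lphi; have [v' [vv' v'v _]] := iv.
pose u := projL v; pose u' := projL v'.
have uu' : u * u' = 1 by rewrite -projLM vv' projL1.
have u'u : u' * u = 1 by rewrite -projLM v'v projL1.
have uu'K : (u : K) * u' = 1 by exact: (congr1 (@bd_inc _ _ _ _) uu').
have u'uK : (u' : K) * u = 1 by exact: (congr1 (@bd_inc _ _ _ _) u'u).
have [psi ipsi] : exists psi : algaut K, inner_by (u : K) psi.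
  by apply: inner_by_ex; exists (u' : K).
have psi0 : inner0 psi by exists u => //; exists u'.
suff -> : phi = psi by [].
have [_ LM LV] := Lambda_subgroup.
have Lpsi : Lambda X R psi by apply: inner0_Lambda.
have : (phi * psi^-1)%g = 1%g.
  apply: In1_Lambda; last by apply: LM => //; exact: LV.
  apply/In1P; exists ((u' : K) * v); first by rewrite projLM projLK u'u.
  apply: inner_byM => //; exact: inner_byV ipsi.
by move=> e; rewrite -[phi](mulgVK psi) e mul1g.
Qed.

Lemma inner_alpha (al : algaut L) : inner L al ->
  exists2 phi, inner0 phi & alpha_aut phi = al.
Proof.
move=> [u iu]; have [u' [uu' u'u _]] := iu.
have [phi iphi] : exists phi : algaut K, inner_by (u : K) phi.
  apply: inner_by_ex; exists (u' : K).
  by split; [exact: (congr1 (@bd_inc _ _ _ _) uu')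
           | exact: (congr1 (@bd_inc _ _ _ _) u'u)].
exists phi; first by exists u => //; exists u'.
exact: inner_by_lift iphi iu.
Qed.

Lemma alpha_inner_set phi : inner K phi -> inner L (alpha_aut phi).
Proof. by move=> [v /alpha_inner h]; exists (projL v). Qed.

End ConditionII.

Arguments alpha_aut {d X T R} phi.
Arguments fix_idem {d X T R} al.

(** * Lifting automorphisms of the poset of classes to X *)

Section OutX.
Local Open Scope order_scope.
Variables (d : Order.disp_t) (X : locFinPreorderType d).
Variable eps : class_bijections X.
Implicit Types (u v c : Xbar X) (x y : X) (q : ordaut (Xbar X)).

Lemma cb_fun_cls u y : class_set (cb_rep eps u) y -> cls (cb_fun eps u y) = u.
Proof. by have [h _ _] := cb_fun_bij eps u; exact: h. Qed.

Lemma cb_fun_onto x :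
  exists2 y, class_set (cb_rep eps (cls x)) y & cb_fun eps (cls x) y = x.
Proof.
have [_ _ h] := cb_fun_bij eps (cls x).
by have [|y] := h x; [| exists y].
Qed.

Lemma cb_transE u v y : class_set (cb_rep eps v) y ->
  cb_trans eps u v (cb_fun eps v y) = cb_fun eps u y.
Proof.
move=> vy; have [_ inj _] := cb_fun_bij eps v.
by rewrite /cb_trans pinvKV //; exact: mem_set.
Qed.

(** This is tau_q. Taking q as a bare function lets [id] and composites be plugged in directly. *)
Definition class_lift (q : Xbar X -> Xbar X) x :=
  cb_trans eps (q (cls x)) (cls x) x.

Lemma cls_class_lift q x : card_preserving q ->
  cls (class_lift q x) = q (cls x).
Proof.
move=> qP; have [y ry yx] := cb_fun_onto x.
rewrite /class_lift -{3}yx.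
by rewrite cb_transE // cb_fun_cls // (cb_rep_eq eps (qP (cls x))).
Qed.

(** Classes of equal cardinality share the base class z, so writing x as the image of a point y of z
    reduces both sides to the image of the same y in the final class. *)
Lemma class_lift_comp q q' x : card_preserving q -> card_preserving q' ->
  class_lift q (class_lift q' x) = class_lift (q \o q') x.
Proof.
move=> qP q'P; rewrite {1}/class_lift cls_class_lift //.
have [y ry yx] := cb_fun_onto x.
have -> : class_lift q' x = cb_fun eps (q' (cls x)) y.
  by rewrite /class_lift -{3}yx cb_transE.
rewrite cb_transE; last by rewrite (cb_rep_eq eps (q'P (cls x))).
by rewrite /class_lift -{4}yx cb_transE.
Qed.

Lemma class_lift_id x : class_lift id x = x.
Proof.
by have [y ry yx] := cb_fun_onto x; rewrite /class_lift -{3}yx cb_transE.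
Qed.

Lemma card_preservingV q : card_preserving q -> card_preserving (q^-1)%g.
Proof. by move=> qP u; rewrite -[in RHS](ordautKV q u) qP. Qed.

Lemma class_lift_ordaut q : card_preserving q -> is_ordaut (class_lift q).
Proof.
move=> qP; have qVP := card_preservingV qP; apply/asboolP; split.
  exists (class_lift (q^-1)%g) => x.
    rewrite (class_lift_comp _ qVP qP).
    rewrite (_ : _ \o _ = id) ?class_lift_id //; apply/funext => u.
    exact: ordautK.
  rewrite (class_lift_comp _ qP qVP).
  rewrite (_ : _ \o _ = id) ?class_lift_id //; apply/funext => u.
  exact: ordautKV.
move=> x y; rewrite -!le_barE !cls_class_lift //.
by have [_ mq] := ordautP q; exact: mq.
Qed.

Lemma Out_X_lift q : card_preserving q ->
  exists2 t, Out_X eps t & forall x, cls (t x) = q (cls x).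
Proof.
move=> qP; exists (OrdAut (class_lift_ordaut qP)); first by exists q.
by move=> x; exact: cls_class_lift.
Qed.

Lemma Out_XP t : Out_X eps t ->
  exists q, card_preserving q /\ forall x, t x = class_lift q x.
Proof. by move=> [q qP tE]; exists q. Qed.

Lemma Out_X_cls1 t : Out_X eps t -> (forall x, cls (t x) = cls x) -> t = 1%g.
Proof.
move=> /Out_XP[q [qP tE]] tc; apply/val_inj/funext => x /=.
have q1 u : q u = u.
  by rewrite -(reprK u); rewrite -[LHS](cls_class_lift _ qP) -tE tc.
by rewrite tE -[RHS](class_lift_id x) /class_lift q1.
Qed.

Lemma Out_X_subgroup : is_subgroup (Out_X eps).
Proof.
split.
- by exists 1%g => // x; exact/esym/class_lift_id.
- move=> s t /Out_XP[q [qP sE]] /Out_XP[q' [q'P tE]]; exists (q * q')%g.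
    by move=> u; rewrite -[(q * q')%g u]/(q (q' u)) qP q'P.
  by move=> x; rewrite -[LHS]/(s (t x)) sE tE class_lift_comp.
- move=> t /Out_XP[q [qP tE]]; exists (q^-1)%g; first exact: card_preservingV.
  move=> x; have qVP := card_preservingV qP.
  have e : t (class_lift (q^-1)%g x) = x.
    rewrite tE (class_lift_comp _ qP qVP) (_ : _ \o _ = id) ?class_lift_id //.
    by apply/funext => u; exact: ordautKV.
  by rewrite -{1}e; exact: ordautK.
Qed.

End OutX.

(** * The embedding of Aut X into Aut K and its effect on the idempotents *)

Section Xi.
Local Open Scope ring_scope.
Variables (d : Order.disp_t) (X : locFinPreorderType d).
Variables (T : comNzRingType) (R : algType T).
Notation K := (incidence X R).
Notation L := (blockdiag X R).
Notation eK c := (bd_inc (idem R c)).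

Lemma xi_morph (S : set (ordaut X)) : morph_on S (@xi _ X _ R).
Proof.
move=> s t _ _; apply: algaut_eq => g; apply: incP => x y.
rewrite algautMg -[LHS]/(g ((s * t)^-1%g x) ((s * t)^-1%g y)).
by rewrite invgM.
Qed.

Lemma xi_Lambda t : Lambda X R (xi R t).
Proof.
apply: Lambda_intro => a; apply: (ex_intro _ (projL (xi R t a))).
apply: incP => x y /=; case: ifP => // /negbT sxy.
have [_ tm] := ordautP (t^-1)%g.
by apply: blockdiag_eq0; rewrite /sim !tm.
Qed.

Lemma xi_idem (t : ordaut X) (q : Xbar X -> Xbar X) c : injective q ->
  (forall x, cls (t x) = q (cls x)) -> alpha (xi R t) (idem R c) = idem R (q c).
Proof.
move=> qI tq; have [_ tm] := ordautP (t^-1)%g.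
apply/blockdiagP/incP => x y; rewrite /alpha /=.
have tx : cls x = q (cls ((t^-1)%g x)) by rewrite -tq (ordautVE t).1.
rewrite (can_eq (ordautVE t).1) tx (inj_eq qI).
case: eqP => [->|] /=; last by rewrite if_same.
by rewrite sim_refl.
Qed.

End Xi.

(** * Diagonal corners as matrix algebras *)

Section CornerMatrix.
Local Open Scope ring_scope.
Variables (d : Order.disp_t) (X : locFinPreorderType d).
Variables (T : comNzRingType) (R : algType T).
Notation K := (incidence X R).
Notation L := (blockdiag X R).
Notation eK c := (bd_inc (idem R c)).

Lemma mem_class (c : Xbar X) x : (x \in fset_set (class_set c)) = (cls x == c).
Proof.
rewrite in_fset_set; last exact: class_set_finite.
by apply/idP/eqP; rewrite inE.
Qed.

Lemma class_card_gt0 (c : Xbar X) : (0 < class_card c)%N.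
Proof.
by rewrite cardfs_gt0; apply/fset0Pn; exists (repr c); rewrite mem_class cls_repr.
Qed.

Lemma class_enum (c : Xbar X) :
  exists (p : 'I_(class_card c) -> X) (i : X -> 'I_(class_card c)),
  [/\ forall k, cls (p k) = c, cancel p i & forall x, cls x = c -> p (i x) = x].
Proof.
pose s : seq X := fset_set (class_set c); pose x0 := repr c.
have k0 := class_card_gt0 c.
have sz : size s = class_card c by [].
have us : uniq s by exact: fset_uniq.
(* Off the class the position is out of range and the index falls back to 0, which exists because a
   class is nonempty. *)
exists (fun k => nth x0 s k), (fun x => insubd (Ordinal k0) (index x s)); split.
- move=> k; apply/eqP; rewrite -mem_class.
  by apply: (@mem_nth _ x0 s); rewrite sz.
- move=> k; apply: val_inj; rewrite val_insubd index_uniq ?sz // ltn_ord //.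
- move=> x /eqP; rewrite -mem_class => xs; rewrite val_insubd.
  have : (index x s < class_card c)%N by rewrite -sz index_mem.
  by move=> ->; apply: nth_index.
Qed.

Section ClassMatrix.
Variables (c : Xbar X) (n : nat) (p : 'I_n -> X) (idx : X -> 'I_n).
Hypotheses (pc : forall k, cls (p k) = c) (pK : cancel p idx)
  (idxK : forall x, cls x = c -> p (idx x) = x).

Definition class_mx (f : K) : 'M[R]_n := \matrix_(i, j) f (p i) (p j).

Fact mx_inc_proof (A : 'M[R]_n) : is_incidence
  (fun x y => if (cls x == c) && (cls y == c) then A (idx x) (idx y) else 0).
Proof.
apply/asboolP => x y xy; case: ifP => // /andP[/eqP xc /eqP yc].
have : sim x y by rewrite -clsP xc yc.
by rewrite /sim (negPf xy).
Qed.

Fact mx_inc_diag (A : 'M[R]_n) : in_L (Incidence (mx_inc_proof A)).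
Proof.
apply/asboolP => x y xy /=; case: ifP => // /andP[/eqP xc /eqP yc].
by move: xy; rewrite -clsP xc yc eqxx.
Qed.

Definition mx_class (A : 'M[R]_n) : L := BlockDiag (mx_inc_diag A).

Lemma class_mxK A : class_mx (mx_class A) = A.
Proof. by apply/matrixP => i j; rewrite mxE /= !pc eqxx /= !pK. Qed.

Lemma mx_classK f : mx_class (class_mx f) = eK c * f * eK c :> K.
Proof.
apply: incP => x y; rewrite mulr_idem mul_idemr /=.
case: (eqVneq (cls x) c) => xc; case: (eqVneq (cls y) c) => yc //=.
by rewrite mxE !idxK.
Qed.

(** For two points of the class the interval between them is the entire class, so the convolution
    sum runs over the same indices as the matrix product. *)
Lemma class_mxM f g : class_mx (f * g) = class_mx f *m class_mx g.
Proof.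
apply/matrixP => i j; rewrite !mxE incM.
have /andP[ij ji] : sim (p i) (p j) by rewrite -clsP !pc.
transitivity (\sum_(z <- map p (index_enum 'I_n)) f (p i) z * g z (p j)).
  apply/perm_big/uniq_perm.
  - exact: fset_uniq.
  - rewrite map_inj_uniq ?index_enum_uniq //; exact: can_inj pK.
  move=> z; rewrite Defs.in_itv; apply/idP/mapP => [/andP[iz zj]|[k _ ->]].
    exists (idx z); first exact: mem_index_enum.
    rewrite idxK //; apply/eqP; rewrite -(pc i) clsP /sim iz.
    by rewrite (le_trans zj ji).
  have /andP[-> ki] : sim (p i) (p k) by rewrite -clsP !pc.
  by rewrite (le_trans ki ij).
by rewrite big_map; apply: eq_bigr => k _; rewrite !mxE.
Qed.

Lemma class_mxB f g : class_mx (f - g) = class_mx f - class_mx g.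
Proof. by apply/matrixP => i j; rewrite !mxE. Qed.

Lemma class_mxZ (t : T) f :
  class_mx (t *: f) = map_mx (fun r => t *: r) (class_mx f).
Proof. by apply/matrixP => i j; rewrite !mxE. Qed.

Lemma class_mx_idem : class_mx (eK c) = 1%:M.
Proof.
apply/matrixP => i j; rewrite !mxE /= pc eqxx andbT.
by rewrite (inj_eq (can_inj pK)).
Qed.

Lemma mx_class_corner A : idem R c * mx_class A * idem R c = mx_class A.
Proof. by apply: blockdiagP; rewrite !blockdiagM -mx_classK class_mxK. Qed.

Lemma mx_class_mul A B : mx_class (A *m B) = mx_class A * mx_class B.
Proof.
have -> : mx_class A * mx_class B = idem R c * (mx_class A * mx_class B) * idem R c.
  have eA : idem R c * mx_class A = mx_class A.
    by rewrite -mx_class_corner !mulrA idemM eqxx.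
  have Be : mx_class B * idem R c = mx_class B.
    by rewrite -mx_class_corner -mulrA idemM eqxx.
  by rewrite mulrA eA -mulrA Be.
by apply: blockdiagP; rewrite !blockdiagM -mx_classK class_mxM !class_mxK.
Qed.

Lemma mx_classB A B : mx_class (A - B) = mx_class A - mx_class B.
Proof.
apply/blockdiagP/incP => x y /=.
rewrite -[RHS]/((mx_class A : K) x y - (mx_class B : K) x y) /=.
by case: ifP; rewrite ?mxE ?subr0.
Qed.

Lemma mx_classZ (t : T) A :
  mx_class (map_mx (fun r => t *: r) A) = t *: mx_class A.
Proof.
apply/blockdiagP/incP => x y /=; rewrite -[RHS]/(t *: (mx_class A : K) x y) /=.
by case: ifP; rewrite ?mxE ?scaler0.
Qed.

Lemma mx_class1 : mx_class 1%:M = idem R c.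
Proof.
by apply: blockdiagP; rewrite -class_mx_idem mx_classK !idemMK !eqxx idemMK eqxx.
Qed.

End ClassMatrix.

(** Matrices over c are identified with the corner at c, carried by al to the corner at c', and read
    off there as matrices. *)
Lemma corner_matrix_iso (al : algaut L) c c' : al (idem R c) = idem R c' ->
  matrix_alg_iso R (class_card c) (class_card c').
Proof.
move=> alc; have [p [i [pc pK iK]]] := class_enum c.
have [p' [i' [pc' pK' iK']]] := class_enum c'.
pose F (A : 'M[R]_(class_card c)) : 'M[R]_(class_card c') :=
  class_mx p' (al (mx_class c i A)).
have alV : (al^-1)%g (idem R c') = idem R c by rewrite -alc algautKg.
have FB : zmod_morphism F.
  by move=> A B; rewrite /F mx_classB algautB -class_mxB.
have FM : monoid_morphism F.
  split=> [|A B]; rewrite /F.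
    by rewrite (mx_class1 pc pK iK) alc (class_mx_idem pc' pK').
  rewrite (mx_class_mul pc pK iK) algaut_mul blockdiagM.
  by rewrite (class_mxM pc' pK' iK').
pose Fr : {rmorphism 'M[R]_(class_card c) -> 'M[R]_(class_card c')} :=
  HB.pack F (GRing.isZmodMorphism.Build _ _ F FB)
            (GRing.isMonoidMorphism.Build _ _ F FM).
exists Fr; split; last first.
  by move=> t A; rewrite /= /F mx_classZ algautZ -class_mxZ.
(* Stated for arbitrary enumerations and an arbitrary automorphism, so that it applies to both al
   and al^-1 and gives the two cancellations. *)
have canF m1 m2 c1 c2 (p1 : 'I_m1 -> X) i1 (p2 : 'I_m2 -> X) i2 (be : algaut L) :
    (forall k, cls (p1 k) = c1) -> cancel p1 i1 ->
    (forall x, cls x = c1 -> p1 (i1 x) = x) ->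
    (forall k, cls (p2 k) = c2) -> cancel p2 i2 ->
    (forall x, cls x = c2 -> p2 (i2 x) = x) ->
    be (idem R c1) = idem R c2 ->
    cancel (fun A => class_mx p2 (be (mx_class c1 i1 A)))
           (fun B => class_mx p1 ((be^-1)%g (mx_class c2 i2 B))).
  move=> h1 h2 h3 k1 k2 k3 be1 A; cbv beta.
  have -> : mx_class c2 i2 (class_mx p2 (be (mx_class c1 i1 A))) =
      be (mx_class c1 i1 A).
    apply: blockdiagP; rewrite (mx_classK k3) -!blockdiagM -be1 -!algaut_mul.
    by rewrite (mx_class_corner h1 h2 h3).
  by rewrite algautKg (class_mxK h1 h2).
exists (fun B => class_mx p ((al^-1)%g (mx_class c' i' B))); first exact: canF.
by have := canF _ _ _ _ _ _ _ _ (al^-1)%g pc' pK' iK' pc pK iK alV; rewrite invgK.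
Qed.

Lemma algaut_corner_iso (al : algaut L) c c' : al (idem R c) = idem R c' ->
  corner_iso (idem R c) (idem R c').
Proof.
move=> alc; exists al; split=> //.
- split.
  + by move=> _ [r _ <-]; exists (al r) => //; rewrite !algaut_mul alc.
  + by move=> a b _ _; exact: (can_inj (algautK al)).
  + move=> _ [r _ <-]; exists (idem R c * (al^-1)%g r * idem R c).
      by exists ((al^-1)%g r).
    by rewrite !algaut_mul alc algautVKg.
- by move=> t a b _ _; rewrite algautD algautZ.
- by move=> a b _ _; rewrite algaut_mul.
Qed.

End CornerMatrix.

(** * The semidirect decompositions of Omega, Lambda and Aut K *)

Section OuterAutomorphisms.
Local Open Scope group_scope.
Variables (d : Order.disp_t) (X : locFinPreorderType d).
Variables (T : comNzRingType) (R : algType T) (eps : class_bijections X).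
Notation K := (incidence X R).
Notation L := (blockdiag X R).
Implicit Types (phi psi : algaut K) (al : algaut L) (c : Xbar X).

Hypothesis cII : condition_II X R.
Hypothesis cardH :
  (forall x y : X, corner_iso (idem R (cls x)) (idem R (cls y)) ->
     class_card (cls x) = class_card (cls y)) \/
  (forall n m : nat, (0 < n)%N -> (0 < m)%N -> matrix_alg_iso R n m -> n = m).

Let alM := alpha_autM cII.
Let alV := alpha_autV cII.
Let al1 := alpha_aut1 cII.

Lemma fix_idemM al be : fix_idem al -> fix_idem be -> fix_idem (al * be).
Proof. by move=> ha hb c; rewrite algautMg hb ha. Qed.

Lemma fix_idemV al : fix_idem al -> fix_idem al^-1.
Proof. by move=> ha c; rewrite -{1}ha algautKg. Qed.

(** Since alpha(phi) permutes the e_c, conjugation by it keeps the property of fixing all of them;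
    this yields the normality of Omega_1, C and In_1 C. *)
Lemma fix_idemJ phi al : fix_idem al ->
  fix_idem (alpha_aut phi * al * (alpha_aut phi)^-1).
Proof.
move=> ha c; have [q qE] := alpha_perm cII (phi^-1).
rewrite !algautMg -alV (alpha_autE cII (phi^-1)) qE ha -qE.
rewrite -(alpha_autE cII (phi^-1)).
by rewrite alV algautVKg.
Qed.

(** The only place where the alternative (1) or (2) enters: alpha(phi) restricts to an isomorphism
    of the corners at u and q(u), also read as one of matrix algebras. *)
Lemma alpha_perm_card phi (q : ordaut (Xbar X)) :
  (forall c, alpha phi (idem R c) = idem R (q c)) -> card_preserving q.
Proof.
rewrite -(alpha_autE cII) => qE u; case: cardH => [h|h]; last first.
  apply/esym/h; try exact: class_card_gt0.
  exact: corner_matrix_iso (qE u).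
rewrite -(cls_repr (q u)) -{2}(cls_repr u); apply/esym/h.
by rewrite !cls_repr; exact: algaut_corner_iso (qE u).
Qed.

Lemma OutX_K_subgroup : is_subgroup (OutX_K R eps).
Proof.
exact: is_subgroup_image (Out_X_subgroup eps) (@xi_morph _ _ _ _ _).
Qed.

Lemma OutX_K_Lambda : OutX_K R eps `<=` Lambda X R.
Proof. by move=> _ [t _ <-]; exact: xi_Lambda. Qed.

Lemma OutX_K_onto phi : exists2 h, OutX_K R eps h &
  forall c, alpha_aut h (idem R c) = alpha_aut phi (idem R c).
Proof.
have [q qE] := alpha_perm cII phi.
have [t tO tq] := Out_X_lift eps (alpha_perm_card qE).
exists (xi R t); first by exists t.
move=> c; rewrite !(alpha_autE cII) qE; apply: xi_idem => //.
exact: can_inj (ordautK q).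
Qed.

Lemma OutX_K_fix h : OutX_K R eps h -> fix_idem (alpha_aut h) -> h = 1.
Proof.
move=> [t tO <-] hf; suff -> : t = 1.
  exact: morph_on1 (is_subgroupT _) (@xi_morph _ _ _ _ _).
have [q [qP tq]] := Out_XP tO.
have tc x : cls (t x) = q (cls x) by rewrite tq (cls_class_lift _ _ qP).
apply: (Out_X_cls1 tO) => x; rewrite tc; apply: (@idem_inj _ _ _ R).
rewrite -[RHS]hf (alpha_autE cII); apply/esym/xi_idem => //.
exact: can_inj (ordautK q).
Qed.

Lemma OutX_K_agree phi h :
  (forall c, alpha_aut h (idem R c) = alpha_aut phi (idem R c)) ->
  fix_idem (alpha_aut (phi * h^-1)).
Proof.
move=> hE c; have [q qE] := alpha_perm cII h^-1.
rewrite alM algautMg (alpha_autE cII h^-1) qE -hE -qE -(alpha_autE cII).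
by rewrite alV algautVKg.
Qed.

(** Every value of alpha is thus attained on a diagonal automorphism, which differs from phi by an
    inner one. *)
Lemma Lambda_lift phi : exists2 lam, Lambda X R lam &
  alpha_aut lam = alpha_aut phi /\ In1 X R (phi * lam^-1).
Proof.
have [psi psi1 Ll] := In1_Lambda_decomp cII phi; exists (psi * phi) => //.
rewrite alM (alpha_In1 cII psi1) mul1g invgM mulVKg; split=> //.
by have [_ _] := In1_subgroup X R; apply.
Qed.

Lemma OmegaE : Omega X R = alpha_aut @` setT.
Proof. exact: diag_imageE. Qed.

Lemma Omega1P al : Omega1 X R al <-> Omega X R al /\ fix_idem al.
Proof. by rewrite /Omega1 /= preserves_RxP. Qed.

Lemma C_Lambda : C X R `<=` Lambda X R.
Proof. by move=> phi /(CP cII)[]. Qed.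

Lemma C_subgroup : is_subgroup (C X R).
Proof.
have [L1 LM LV] := Lambda_subgroup cII; split.
- by apply/(CP cII); rewrite al1.
- move=> phi psi /(CP cII)[? ?] /(CP cII)[? ?]; apply/(CP cII); rewrite alM.
  by split; [exact: LM | exact: fix_idemM].
- move=> phi /(CP cII)[? ?]; apply/(CP cII); rewrite alV.
  by split; [exact: LV | exact: fix_idemV].
Qed.

Lemma Omega1E : Omega1 X R = alpha_aut @` C X R.
Proof.
apply/seteqP; split=> al.
  move=> /Omega1P[]; rewrite OmegaE => -[phi _ <-] hf.
  have [lam Ll [le _]] := Lambda_lift phi; exists lam => //.
  by apply/(CP cII); rewrite le.
move=> [phi /(CP cII)[_ hf] <-]; apply/Omega1P; split=> //.
by rewrite OmegaE; exists phi.
Qed.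

Lemma Omega_sdprod : is_sdprod (Omega X R) (Omega1 X R) (OutX_L R eps).
Proof.
have sgO : is_subgroup (Omega X R).
  rewrite OmegaE; apply: is_subgroup_image (is_subgroupT _) _.
  exact: alpha_aut_morph.
have OXE : OutX_L R eps = alpha_aut @` OutX_K R eps by exact: diag_imageE.
apply: sdprod_intro => //.
- rewrite Omega1E; apply: is_subgroup_image C_subgroup _; exact: alpha_aut_morph.
- rewrite OXE; apply: is_subgroup_image OutX_K_subgroup _; exact: alpha_aut_morph.
- split=> [al /Omega1P[]//|].
  apply: normaliser_conj_on => // g x Og /Omega1P[Ox hx].
  have [_ OM OV] := sgO; apply/Omega1P; split.
    by apply: (OM); [exact: OM | exact: OV].
  by move: Og; rewrite OmegaE => -[phi _ <-]; exact: fix_idemJ.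
- by rewrite OXE OmegaE => _ [h _ <-]; exists h.
- move=> x /Omega1P[_ hx]; rewrite OXE => -[h Oh he].
  by rewrite -he (OutX_K_fix Oh) ?al1 // he.
- move=> al Oal; have := Oal; rewrite OmegaE => -[phi _ pe].
  have [h Oh he] := OutX_K_onto phi; exists (alpha_aut h).
    by rewrite OXE; exists h.
  rewrite -pe -alV -alM; apply/Omega1P; split; last exact: OutX_K_agree.
  by rewrite OmegaE; exists (phi * h^-1).
Qed.

Lemma Lambda_sdprod : is_sdprod (Lambda X R) (C X R) (OutX_K R eps).
Proof.
have [_ LM LV] := Lambda_subgroup cII.
apply: sdprod_intro.
- exact: Lambda_subgroup.
- exact: C_subgroup.
- exact: OutX_K_subgroup.
- split=> [phi /(CP cII)[]//|].
  apply: normaliser_conj_on; first exact: Lambda_subgroup.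
  move=> g x Lg /(CP cII)[Lx hx]; apply/(CP cII); split.
    by apply: (LM); [exact: LM | exact: LV].
  by rewrite !alM alV; exact: fix_idemJ.
- exact: OutX_K_Lambda.
- by move=> x /(CP cII)[_ hx] /OutX_K_fix; apply.
- move=> phi Lphi; have [h Oh he] := OutX_K_onto phi; exists h => //.
  apply/(CP cII); split; last exact: OutX_K_agree.
  by apply: LM => //; apply/LV/OutX_K_Lambda.
Qed.

(** The product is the kernel of the action of Aut K on the classes; in this form it is visibly a
    normal subgroup with complement Out X. *)
Lemma In1_CE :
  set_mulg (In1 X R) (C X R) = [set phi : algaut K | fix_idem (alpha_aut phi)].
Proof.
apply/seteqP; split=> phi /=.
  move=> [psi psi1 [lam /(CP cII)[_ hl] <-]].
  by rewrite alM (alpha_In1 cII psi1) mul1g.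
move=> hf; have [lam Ll [le i1]] := Lambda_lift phi.
exists (phi * lam^-1) => //; exists lam; rewrite ?mulgVK //.
by apply/(CP cII); rewrite le.
Qed.

Lemma algaut_sdprod3 : is_sdprod3 (setT : set (algaut K))
  (In1 X R) (C X R) (OutX_K R eps).
Proof.
have sgF : is_subgroup [set phi : algaut K | fix_idem (alpha_aut phi)].
  split=> [|phi psi|phi] /=; rewrite ?al1 ?alM ?alV //.
    exact: fix_idemM.
  exact: fix_idemV.
have [_ _ _ _ CO] := Lambda_sdprod.
have in1_nf (S : set (algaut K)) : S `<=` normaliser (In1 X R).
  by move=> phi _; exact: In1_normal.
split; split.
- rewrite In1_CE; apply: sdprod_intro => //.
  + exact: In1_subgroup.
  + exact: C_subgroup.
  + by split=> // phi /(alpha_In1 cII) h; rewrite /= h.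
  + by move=> phi /(CP cII)[].
  + by move=> phi i1 /(CP cII)[Lp _]; exact: In1_Lambda i1 Lp.
  + move=> phi hf; have [lam Ll [le i1]] := Lambda_lift phi; exists lam => //.
    by apply/(CP cII); rewrite le.
- rewrite In1_CE; apply: sdprod_intro => //.
  + exact: OutX_K_subgroup.
  + split=> // phi _; apply: (@normaliser_conj_on _ setT) => //.
    move=> g x _ hx; rewrite /= !alM alV; exact: fix_idemJ.
  + by move=> x hx /OutX_K_fix; apply.
  + move=> phi _; have [h Oh he] := OutX_K_onto phi; exists h => //.
    exact: OutX_K_agree.
- by rewrite CO; exact: Lambda_sdprod.
- rewrite CO; apply: sdprod_intro => //.
  + exact: In1_subgroup.
  + exact: Lambda_subgroup.
  + exact: In1_Lambda.
  + by move=> phi _; have [lam Ll [_ i1]] := Lambda_lift phi; exists lam.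
Qed.

(** * Psi, the subgroups In_0 and Psi_0, and the outer automorphism group *)

Lemma PsiP phi : Psi X R phi <-> Lambda X R phi /\ alpha_aut phi = 1.
Proof.
rewrite /Psi /Lambda /= -(alpha_autE cII); split=> [[e Lp]|[Lp e]].
  by split=> //; apply: algaut_eq => a; rewrite e.
by rewrite e.
Qed.

Lemma Psi_subgroup : is_subgroup (Psi X R).
Proof.
have [L1 LM LV] := Lambda_subgroup cII; split.
- by apply/PsiP.
- move=> phi psi /PsiP[? e] /PsiP[? e']; apply/PsiP.
  by rewrite alM e e' mulg1; split=> //; exact: LM.
- move=> phi /PsiP[? e]; apply/PsiP.
  by rewrite alV e invg1; split=> //; exact: LV.
Qed.

Lemma Psi_C : Psi X R `<=` C X R.
Proof. by move=> phi /PsiP[Lp e]; apply/(CP cII); rewrite e. Qed.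

Lemma PsiJ phi psi : Lambda X R phi -> Psi X R psi ->
  Psi X R (phi * psi * phi^-1).
Proof.
have [L1 LM LV] := Lambda_subgroup cII.
move=> Lphi /PsiP[Lpsi e]; apply/PsiP; split.
  by apply: (LM); [exact: LM | exact: LV].
by rewrite !alM alV e mulg1 mulgV.
Qed.

Lemma In0J phi psi : Lambda X R phi -> inner0 psi ->
  inner0 (phi * psi * phi^-1).
Proof.
move=> /(LambdaP phi) Lphi [u uI iu]; exists (alpha_aut phi u).
  exact: invertible_algaut.
by rewrite alpha_autE // -Lphi; exact: inner_by_conj.
Qed.

Lemma Psi0J phi psi : Lambda X R phi -> Psi0_set psi ->
  Psi0_set (phi * psi * phi^-1).
Proof.
move=> /(LambdaP phi) Lphi [u [uI cu iu]]; exists (alpha_aut phi u); split.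
- exact: invertible_algaut.
- by move=> a; rewrite -[a](algautVKg (alpha_aut phi)) -!algaut_mul cu.
- by rewrite alpha_autE // -Lphi; exact: inner_by_conj.
Qed.

Lemma normaliser_In0 : Lambda X R `<=` normaliser (In0 X R).
Proof.
by apply: normaliser_conj_on; [exact: Lambda_subgroup | exact: In0J].
Qed.

Lemma normaliser_Psi0 : Lambda X R `<=` normaliser (Psi0 X R).
Proof.
by apply: normaliser_conj_on; [exact: Lambda_subgroup | exact: Psi0J].
Qed.

Lemma Psi0_In0 : Psi0 X R `<=` In0 X R.
Proof. by move=> phi [u [uI _ iu]]; exists u. Qed.

(** On L the automorphism is conjugation by u, and this is trivial exactly when u is central in
    L. *)
Lemma In0_alpha1 phi : inner0 phi -> alpha_aut phi = 1 -> Psi0_set phi.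
Proof.
move=> [u uI iu] e; exists u; split=> // a.
have /alpha_inner := iu; rewrite e projLK // => /(_ cII) h.
exact: (inner_byE a h).
Qed.

Lemma Psi0_Psi : Psi0 X R `<=` Psi X R.
Proof.
move=> phi p0; apply/PsiP; split; first exact/inner0_Lambda/Psi0_In0.
have [u [_ cu /(alpha_inner cII)]] := p0; rewrite projLK => -[w [_ wu e]].
by apply: algaut_eq => a; rewrite e -mulrA -cu mulrA wu mul1r.
Qed.

(** Lets Out K be computed from a smaller group of representatives, such as Lambda, to which
    [isog_images] can be applied. *)
Lemma Out_KE (S : set (algaut K)) :
  (forall phi, exists2 s, S s & inner K (phi * s^-1)) ->
  quotient S (In_Aut K) = Out_K X R.
Proof.
move=> h; apply/seteqP; split=> _ [phi Sphi <-]; first by exists phi.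
have [s Ss i] := h phi; exists s => //.
rewrite -[phi in RHS](mulgVK s) coset_morph; try exact: inner_normal.
have -> : coset (In_Aut K) (phi * s^-1) = 1.
  by apply/coset_eq1 => //; exact: inner_normal.
by rewrite mul1g.
Qed.

Lemma coset_Out_K (S : set (algaut K)) : morph_on S (coset (In_Aut K)).
Proof. by apply: coset_morph_on => phi _; exact: inner_normal. Qed.

(** Lambda meets every class of Out K and its inner elements form In_0, so Out K is Lambda/In_0; the
    splitting of Lambda then passes to this quotient. *)
Lemma Out0_K_isog :
  isog_sdprod (Out_K X R) (Out0_K X R) (OutX_K R eps) (coset_conj (In0 X R)).
Proof.
apply: (isog_sdprod_trans _ OutX_K_subgroup).
- apply: is_subgroup_image C_subgroup _.
  by apply: coset_morph_on => phi /C_Lambda; exact: normaliser_In0.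
- apply: isog_sdprod_quotient Lambda_sdprod _ normaliser_In0.
  exact: inner0_C.
rewrite -(@Out_KE (Lambda X R)); last first.
  move=> phi; have [lam Ll [_ i1]] := Lambda_lift phi; exists lam => //.
  exact: In1_inner.
apply: isog_images (Lambda_subgroup cII) _ _ _.
- exact/coset_morph_on/normaliser_In0.
- exact: coset_Out_K.
- move=> phi Lp; rewrite !coset_eq1; last exact: normaliser_In0.
    by split; [exact: inner0_inner | move=> i; exact: inner_Lambda i Lp].
  exact: inner_normal.
Qed.

(** An inner automorphism of L lifts to In_0, so dividing phi by the lift leaves trivial alpha. On
    Lambda the kernel modulo In(Aut L) is therefore Psi In_0. *)
Lemma inner_L_In0 phi : Lambda X R phi ->
  inner L (alpha_aut phi) <->
  exists2 phi0, inner0 phi0 & Psi X R (phi * phi0^-1).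
Proof.
have [_ LM LV] := Lambda_subgroup cII.
move=> Lp; split=> [/(inner_alpha cII)[phi0 i0 e]|[phi0 i0 /PsiP[_ e]]].
  exists phi0 => //; apply/PsiP; rewrite alM alV e mulgV; split=> //.
  by apply: LM => //; apply/LV/inner0_Lambda.
suff -> : alpha_aut phi = alpha_aut phi0.
  exact/(alpha_inner_set cII)/inner0_inner.
by rewrite -[phi](mulgVK phi0) alM e mul1g.
Qed.

(** F is the image of Psi in C/In_0. On Psi the kernel is Psi_0; on C, the maps to Out_0 K / F and
    to Omega_1/In(Aut L) both have kernel Psi In_0. *)
Lemma Out0_K_extension : exists F : subgroup (coset_of (In0 X R)),
  [/\ normal_in F (Out0_K X R),
      isog F (quotient (Psi X R) (Psi0 X R)) &
      isog (quotient (Out0_K X R) F)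
           (quotient (Omega1 X R) (In_Aut L))].
Proof.
have nC : C X R `<=` normaliser (In0 X R).
  by move=> phi /C_Lambda; exact: normaliser_In0.
have nPsi : Psi X R `<=` normaliser (In0 X R) by move=> phi /Psi_C; exact: nC.
have mPsi := coset_morph_on nPsi.
have sgOut0 : is_subgroup (Out0_K X R).
  exact/(is_subgroup_image C_subgroup)/coset_morph_on.
pose F := Subgroup (is_subgroup_image Psi_subgroup mPsi).
have nF : Out0_K X R `<=` normaliser F.
  apply: normaliser_conj_on => // _ _ [phi Cp <-] [psi Pp <-].
  exists (phi * psi * phi^-1); first by apply: PsiJ => //; exact: C_Lambda.
  rewrite !coset_morph ?coset_inv //; try by [exact: nC | exact: nPsi].
    by apply: normaliserM; [exact: nC | exact: nPsi].
  exact/normaliserV/nC.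
exists F; split.
- by split=> // _ [psi /Psi_C Cp <-]; exists psi.
- apply: isog_images Psi_subgroup (mPsi) _ _.
    by apply: coset_morph_on => phi /Psi_C/C_Lambda; exact: normaliser_Psi0.
  move=> phi Pp; rewrite !coset_eq1; last exact: nPsi.
    split; last exact: Psi0_In0.
    by have /PsiP[_ e] := Pp => i0; exact: In0_alpha1.
  by apply: normaliser_Psi0; apply: C_Lambda; exact: Psi_C.
- rewrite /Out0_K /quotient Omega1E !image_comp.
  have mC := coset_morph_on nC.
  apply: isog_images C_subgroup _ _ _.
  + move=> phi psi Cp Cq; rewrite /= mC // coset_morph //; apply: nF.
      by exists phi.
    by exists psi.
  + move=> phi psi _ _; rewrite /= alM coset_morph //; exact: inner_normal.
  + move=> phi Cp; rewrite /= coset_eq1; last by apply: nF; exists phi.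
    rewrite coset_eq1; last exact: inner_normal.
    rewrite [X in _ <-> X]inner_L_In0; last exact: C_Lambda.
    split=> [[psi Pp e]|[phi0 i0 Pp]].
      exists (psi^-1 * phi); first exact/(coset_eq (nPsi _ Pp) (nC _ Cp)).
      by rewrite invgM invgK mulVKg.
    exists (phi * phi0^-1) => //; apply/(coset_eq (nPsi _ Pp) (nC _ Cp)).
    by rewrite invgM invgK mulgVK.
Qed.

Lemma Out_K_isog_Omega1 : Psi X R = Psi0 X R ->
  isog_sdprod (Out_K X R) (quotient (Omega1 X R) (In_Aut L))
    (OutX_L R eps) (coset_conj (In_Aut L)).
Proof.
move=> PP; have [sg1 sgX _ _ _] := Omega_sdprod.
have [I1 IM IV] := inner_subgroup K.
have nL (S : set (algaut L)) : S `<=` normaliser (In_Aut L).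
  by move=> al _; exact: inner_normal.
apply: (isog_sdprod_trans _ sgX).
- exact/(is_subgroup_image sg1)/coset_morph_on.
- apply: isog_sdprod_quotient Omega_sdprod _ _ => //.
  move=> al /(inner_alpha cII)[phi i0 <-]; rewrite Omega1E; exists phi => //.
  exact: inner0_C.
rewrite OmegaE /quotient image_comp.
apply: isog_images (is_subgroupT _) _ _ _.
- by move=> phi psi _ _; rewrite /= alM coset_morph //; exact: inner_normal.
- exact: coset_Out_K.
move=> phi _; rewrite /= !coset_eq1; try exact: inner_normal.
split; last exact: alpha_inner_set.
(* An inner alpha must force phi to be inner. A diagonal representative lies in Psi In_0, which is
   In_0 as Psi = Psi_0. *)
have [lam Ll [le /In1_inner i1]] := Lambda_lift phi.
move=> i; have : inner L (alpha_aut lam) by rewrite le.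
move=> /(inner_L_In0 Ll)[phi0 /inner0_inner i0]; rewrite PP.
move=> /Psi0_In0/inner0_inner i2.
rewrite -[phi](mulgVK lam); apply: (IM) => //.
by rewrite -[lam](mulgVK phi0); apply: IM.
Qed.

Lemma Out_K_isog_Psi : Omega1 X R = inner L ->
  isog_sdprod (Out_K X R) (quotient (Psi X R) (Psi0 X R))
    (OutX_K R eps) (coset_conj (Psi0 X R)).
Proof.
move=> OI; have [_ LM LV] := Lambda_subgroup cII.
have [I1 IM IV] := inner_subgroup K.
have [O1 OM OV] := OutX_K_subgroup.
(* D is the product of Psi and Out X, described through alpha; it will be shown to represent all of
   Out K. *)
pose D : set (algaut K) := [set phi | Lambda X R phi /\
  exists2 h, OutX_K R eps h & alpha_aut phi = alpha_aut h].
have sgD : is_subgroup D.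
  split.
  - by split; [case: (Lambda_subgroup cII) | exists 1].
  - move=> phi psi [Lp [h Oh e]] [Lq [k Ok e']]; split; first exact: LM.
    by exists (h * k); [exact: OM | rewrite !alM e e'].
  - move=> phi [Lp [h Oh e]]; split; first exact: LV.
    by exists h^-1; [exact: OV | rewrite !alV e].
have nD : D `<=` normaliser (Psi0 X R).
  by move=> phi [Lp _]; exact: normaliser_Psi0.
have sdD : is_sdprod D (Psi X R) (OutX_K R eps).
  apply: sdprod_intro => //.
  - exact: Psi_subgroup.
  - split=> [phi /PsiP[Lp e]|]; first by split=> //; exists 1; rewrite ?al1.
    by apply: normaliser_conj_on => // g x [Lg _]; exact: PsiJ.
  - by move=> h Oh; split; [exact: OutX_K_Lambda | exists h].
  - by move=> h /Psi_C/(CP cII)[_ hf] Oh; exact: OutX_K_fix.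
  - move=> phi [Lp [h Oh e]]; exists h => //; apply/PsiP; split.
      by apply: LM => //; apply/LV/OutX_K_Lambda.
    by rewrite alM alV e mulgV.
apply: (isog_sdprod_trans _ OutX_K_subgroup).
- apply/(is_subgroup_image Psi_subgroup)/coset_morph_on => phi /Psi_C/C_Lambda.
  exact: normaliser_Psi0.
- apply: isog_sdprod_quotient sdD _ nD; exact: Psi0_Psi.
rewrite -(@Out_KE D); last first.
  move=> phi; have [lam Ll [le /In1_inner i1]] := Lambda_lift phi.
  have [h Oh he] := OutX_K_onto lam.
  have Cc : C X R (lam * h^-1).
    apply/(CP cII); split; last exact: OutX_K_agree.
    by apply: LM => //; apply/LV/OutX_K_Lambda.
  have : inner L (alpha_aut (lam * h^-1)).
    by rewrite -OI Omega1E; exists (lam * h^-1).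
  move=> /(inner_alpha cII)[phi0 i0 e0].
  (* [phi0] lies in In_0 and has the same alpha as lam h^-1, so removing it leaves a diagonal
     automorphism with the alpha of h, that is, an element of D. *)
  exists (phi0^-1 * lam).
    split; first by apply: LM => //; apply/LV/inner0_Lambda.
    exists h => //; rewrite -[lam](mulgVK h) !alM alV -alM -e0 mulKg //.
  rewrite invgM invgK mulgA; apply: (IM) => //; exact: inner0_inner.
apply: isog_images sgD _ _ _.
- exact: coset_morph_on.
- exact: coset_Out_K.
move=> phi Dp; rewrite !coset_eq1; [|exact: inner_normal|exact: nD].
split; first by move=> /Psi0_In0/inner0_inner.
have [Lp [h Oh e]] := Dp => i; have i0 := inner_Lambda cII i Lp.
(* An inner element of D lies in In_0 and so fixes every e_c under alpha; then h = 1, alpha is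
   trivial, and the element is in Psi_0. *)
apply: In0_alpha1 => //; rewrite e (OutX_K_fix Oh) ?al1 // -e.
by have /(CP cII)[] := inner0_C cII i0.
Qed.

End OuterAutomorphisms.

Theorem theorem9p1 (T : comNzRingType) (R : algType T)
    (d : Order.disp_t) (X : locFinPreorderType d) (eps : class_bijections X) :
  condition_II X R ->
  (forall x y : X,
     corner_iso (idem R (cls x)) (idem R (cls y)) ->
     class_card (cls x) = class_card (cls y)) \/
  (forall n m : nat, (0 < n)%N -> (0 < m)%N -> matrix_alg_iso R n m -> n = m) ->
  [/\ is_sdprod (Omega X R) (Omega1 X R) (OutX_L R eps),
      is_sdprod (Lambda X R) (C X R) (OutX_K R eps) &
      is_sdprod3 (setT : set (algaut (incidence X R)))
        (In1 X R) (C X R) (OutX_K R eps)] /\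
  [/\ isog_sdprod (Out_K X R) (Out0_K X R) (OutX_K R eps)
        (coset_conj (In0 X R)) /\
      (exists F : subgroup (coset_of (In0 X R)),
         [/\ normal_in F (Out0_K X R),
             isog F (quotient (Psi X R) (Psi0 X R)) &
             isog (quotient (Out0_K X R) F)
                  (quotient (Omega1 X R) (In_Aut (blockdiag X R)))]),
      Psi X R = Psi0 X R ->
      isog_sdprod (Out_K X R)
        (quotient (Omega1 X R) (In_Aut (blockdiag X R)))
        (OutX_L R eps) (coset_conj (In_Aut (blockdiag X R))) &
      Omega1 X R = inner (blockdiag X R) ->
      isog_sdprod (Out_K X R) (quotient (Psi X R) (Psi0 X R))
        (OutX_K R eps) (coset_conj (Psi0 X R))].
Proof.
move=> cII cardH; split.
  split; [exact: Omega_sdprod | exact: Lambda_sdprod | exact: algaut_sdprod3].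
split; [split | exact: Out_K_isog_Omega1 | exact: Out_K_isog_Psi].
  exact: Out0_K_isog.
exact: Out0_K_extension.
Qed.
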